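(* Let $\Sigma_1,\Sigma_2$ be systems as in the context, $\tilde n=n_1+n_2$, $Q_{i,\tilde n}=\mathcal{O}bs_{\tilde n}(A_i,C_i)$, and let $\mathcal R\subseteq\mathbb R^{n_1}\times\mathbb R^{n_2}$ be a subspace. Then $\Sigma_1$ and $\Sigma_2$ have equivalent stochastic external behavior with respect to $\mathcal R$ if and only if the following hold: $(p_0)$ $\Psi_1=\Psi_2$; $(p_1)$ $C_1A_1^tB_1=C_2A_2^tB_2$ for all $t\ge0$; $(p_2)$ $C_1A_1^tG_1\mu_1=C_2A_2^tG_2\mu_2$ for all $t\ge0$; $(p_3)$ $C_1A_1^kG_1G_1^T(A_1^h)^TC_1^T=C_2A_2^kG_2G_2^T(A_2^h)^TC_2^T$ for all $h,k\ge0$; and $(p_4)$ $\mathcal R\subseteq\ker([Q_{1,\tilde n}\ \ -Q_{2,\tilde n}])$. Moreover, if $\Sigma_1$ and $\Sigma_2$ have equivalent stochastic external behavior with respect to $\mathcal R$, there exists a $\mathrm{diag}(A_1,A_2)$-invariant subspace $\mathcal R'\supseteq\mathcal R$ such that $\Sigma_1$ and $\Sigma_2$ have equivalent stochastic external behavior with respect to $\mathcal R'$.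
   Context: For $i=1,2$, $\Sigma_i$ is the system $x_i(t+1)=A_ix_i(t)+B_iu(t)+G_iw_i(t)$, $y_i(t)=C_ix_i(t)+\nu_i(t)$, $t\in\mathbb{N}$, with $x_i\in\mathbb{R}^{n_i}$, $u\in\mathbb{R}^m$, $w_i\in\mathbb{R}^{l_i}$, $y_i,\nu_i\in\mathbb{R}^p$, where $(w_i(t))_t$ is i.i.d. with $w_i(t)\sim\mathcal N(\mu_i,I_{l_i})$, $(\nu_i(t))_t$ is i.i.d. with $\nu_i(t)\sim\mathcal N(0,\Psi_i)$, and the two sequences are mutually independent. For a deterministic initial state $x_i^0$ and deterministic input $\mathbf u:\mathbb N\to\mathbb R^m$, $\mathbf x_i|_{x_i^0,\mathbf u}(t)=A_i^tx_i^0+\sum_{\tau=0}^{t-1}A_i^{t-1-\tau}(B_iu(\tau)+G_iw_i(\tau))$, $\mathbf y_i|_{x_i^0,\mathbf u}(t)=C_i\mathbf x_i|_{x_i^0,\mathbf u}(t)+\nu_i(t)$. Processes are stochastically equivalent ($\sim$) if all finite-dimensional joint distributions coincide. For a subspace $\mathcal R\subseteq\mathbb R^{n_1}\times\mathbb R^{n_2}$, $\Sigma_1,\Sigma_2$ have equivalent stochastic external behavior with respect to $\mathcal R$ if $\mathbf y_1|_{x_1^0,\mathbf u}\sim\mathbf y_2|_{x_2^0,\mathbf u}$ for all $(x_1^0,x_2^0)\in\mathcal R$ and all inputs $\mathbf u$. $\mathcal{O}bs_k(A,C)$ is the matrix obtained by stacking $C,CA,\dots,CA^{k-1}$ vertically.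 $\mathrm{diag}(A_1,A_2)$ is the block-diagonal matrix. *)

(* Defs.v *)
From HB Require Import structures.
From mathcomp Require Import all_boot all_order all_algebra.
From mathcomp Require Import all_classical all_reals.
From mathcomp Require Import ereal topology normedtype sequences measure
  lebesgue_measure lebesgue_integral probability normal_distribution.

Set Implicit Arguments.
Unset Strict Implicit.
Unset Printing Implicit Defensive.

Import Order.TTheory GRing.Theory Num.Theory.
Local Open Scope classical_set_scope.
Local Open Scope ring_scope.

Section Defs.
Context {R : realType}.

Definition rects (J : finType) : set (set (J -> R)) :=
  [set [set x : J -> R | forall j, A j (x j)] |
     A in [set A : J -> set R | forall j, measurable (A j)]].

Definition borel_fin (J : finType) : set (set (J -> R)) :=
  smallest (sigma_algebra setT) (@rects J).

Definition gauss_law (m v : R) : set R -> \bar R :=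
  if v == 0 then dirac m else normal_prob m (Num.sqrt v).

Section Prob.
Context {d : measure_display} {T : measurableType d} (P : probability T R).

Definition gaussian_vec (J : finType) (X : T -> J -> R) (mu : J -> R)
    (S : J -> J -> R) : Prop :=
  forall (a : J -> R) (B : set R), measurable B ->
    P [set w | B (\sum_j a j * X w j)] =
    gauss_law (\sum_j a j * mu j) (\sum_j \sum_k a j * S j k * a k) B.

Definition mutually_indep (I : eqType) (D : I -> finType)
    (X : forall k, T -> (D k -> R)) : Prop :=
  forall (s : seq I) (B : forall k, set (D k -> R)),
    uniq s -> (forall k, borel_fin (B k)) ->
    P [set w | forall k, k \in s -> B k (X k w)] =
    (\prod_(k <- s) P [set w | B k (X k w)])%E.

(** Noise of a system: family indexed by inl t (process noise w(t)) and
    inr t (measurement noise nu(t)). *)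
Definition noise_dim (l p : nat) (k : nat + nat) : finType :=
  match k with inl _ => 'I_l | inr _ => 'I_p end.

Definition noise_family (l p : nat) (w : nat -> T -> 'cV[R]_l)
    (nu : nat -> T -> 'cV[R]_p) : forall k, T -> (noise_dim l p k -> R) :=
  fun k => match k as k0 return T -> (noise_dim l p k0 -> R) with
           | inl t => fun om j => w t om j 0
           | inr t => fun om j => nu t om j 0
           end.

(** Standing assumptions of the context: (w(t))_t i.i.d. N(mu, I_l),
    (nu(t))_t i.i.d. N(0, Psi), the two sequences mutually independent. *)
Definition noise_model (l p : nat) (mu : 'cV[R]_l) (Psi : 'M[R]_p)
    (w : nat -> T -> 'cV[R]_l) (nu : nat -> T -> 'cV[R]_p) : Prop :=
  [/\ (forall t j, measurable_fun setT (fun om => w t om j 0)),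
      (forall t j, measurable_fun setT (fun om => nu t om j 0)),
      (forall t, gaussian_vec (fun om j => w t om j 0) (fun j => mu j 0)
                   (fun j k => (1%:M : 'M[R]_l) j k)),
      (forall t, gaussian_vec (fun om j => nu t om j 0) (fun _ => 0)
                   (fun j k => Psi j k)) &
      mutually_indep (noise_family w nu)].

Definition state_traj (n m l : nat) (A : 'M[R]_n) (B : 'M[R]_(n, m))
    (G : 'M[R]_(n, l)) (w : nat -> T -> 'cV[R]_l) (x0 : 'cV[R]_n)
    (u : nat -> 'cV[R]_m) (t : nat) (om : T) : 'cV[R]_n :=
  A ^+ t *m x0 +
  \sum_(tau < t) A ^+ (t.-1 - tau) *m (B *m u tau + G *m w tau om).

Definition output_traj (n m l p : nat) (A : 'M[R]_n) (B : 'M[R]_(n, m))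
    (G : 'M[R]_(n, l)) (C : 'M[R]_(p, n)) (w : nat -> T -> 'cV[R]_l)
    (nu : nat -> T -> 'cV[R]_p) (x0 : 'cV[R]_n) (u : nat -> 'cV[R]_m)
    (t : nat) (om : T) : 'cV[R]_p :=
  C *m state_traj A B G w x0 u t om + nu t om.

End Prob.

Definition stoch_equiv (p : nat)
    {d1 : measure_display} {T1 : measurableType d1} (P1 : probability T1 R)
    (Y1 : nat -> T1 -> 'cV[R]_p)
    {d2 : measure_display} {T2 : measurableType d2} (P2 : probability T2 R)
    (Y2 : nat -> T2 -> 'cV[R]_p) : Prop :=
  forall (k : nat) (ts : 'I_k -> nat) (B : set ('I_k * 'I_p -> R)),
    borel_fin B ->
    P1 [set om | B (fun ij => Y1 (ts ij.1) om ij.2 0)] =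
    P2 [set om | B (fun ij => Y2 (ts ij.1) om ij.2 0)].

Fixpoint Obs (n p : nat) (A : 'M[R]_n) (C : 'M[R]_(p, n)) (k : nat)
  : 'M[R]_(k * p, n) :=
  match k return 'M[R]_(k * p, n) with
  | 0 => 0
  | k'.+1 => col_mx C (Obs A C k' *m A)
  end.

Definition is_subspace (N : nat) (S : set 'cV[R]_N) : Prop :=
  S 0 /\ forall (a : R) (x y : 'cV[R]_N), S x -> S y -> S (a *: x + y).

End Defs.

(* Main.v *)
Require Import Defs.
From HB Require Import structures.
From mathcomp Require Import all_boot all_order all_algebra.
From mathcomp Require Import all_classical all_reals.
From mathcomp Require Import ereal topology normedtype sequences measure
  lebesgue_measure lebesgue_integral probability normal_distribution.
From mathcomp Require Import numfun exp trigo measurable_realfun charge.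
From mathcomp Require Import ring lra zify.
Import Order.TTheory GRing.Theory Num.Theory.
Import numFieldNormedType.Exports.
Local Open Scope classical_set_scope.
Local Open Scope ring_scope.

(** Each output process is a constant trajectory plus a moving average of the
    process noise plus the measurement noise.  Hence every linear combination
    of finitely many outputs is a sum of independent Gaussian variables, so it
    is Gaussian, with mean and variance explicit in [C A^t x0], [C A^t B],
    [C A^t G mu], [C A^k G G^T (A^h)^T C^T] and [Psi].  By the Cramer-Wold
    theorem the finite-dimensional laws coincide iff these means and variances
    coincide for all coefficients; varying the coefficients, the input (zero or
    an impulse) and the horizon isolates the five conditions, and the
    Cayley-Hamilton theorem for [diag(A1, A2)] reduces the condition on the
    initial states to the first [n1 + n2] powers.  The largest admissible
    [R'] is the unobservable subspace of [diag(A1, A2)] for [C1 -C2].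

    Cramer-Wold is proved without Fourier inversion: equality in law of all
    linear forms gives equal expectations of all trigonometric polynomials, and
    these approximate indicators of orthants boundedly and pointwise, through
    polynomials in [sin] converging to the sign function. *)

(** * Normal laws *)

Section gauss.
Context {R : realType}.
Local Notation mR := (measurableTypeR R).
Local Notation leb := (@lebesgue_measure R).

(** [gauss_law] is a bare set function; here the same law carries the probability structure needed
    to integrate against it and to form product measures. *)
Definition gauss_prob (m v : R) : probability mR R :=
  if v == 0 then (@dirac _ mR m R : probability mR R)
  else (normal_prob m (Num.sqrt v) : probability mR R).

Lemma gauss_probE m v B : gauss_law m v B = gauss_prob m v B.
Proof. by rewrite /gauss_law /gauss_prob; case: ifP. Qed.

Lemma measurable_addl (x : R) : measurable_fun setT (fun y : mR => x + y : mR).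
Proof. by apply: measurable_funD. Qed.

(** The translated measure gives every half-open interval its length, and this characterizes
    Lebesgue measure. *)
Lemma lebesgue_measure_shift (x : R) (A : set mR) : measurable A ->
  leb A = pushforward leb (fun y : mR => x + y : mR) A.
Proof.
move=> mA.
pose phi : {mfun mR >-> mR} := HB.pack (fun y : mR => x + y : mR)
  (isMeasurableFun.Build _ _ _ _ _ (measurable_addl x)).
apply: (lebesgue_measure_unique (mu := pushforward leb phi)) => // _ [[a b] _ <-].
transitivity (leb `]a - x, b - x]%classic).
  rewrite !lebesgue_measure_itv/= !lte_fin ltrD2r.
  by case: ifPn => // _; rewrite -!EFinB; congr EFin; ring.
rewrite /pushforward; congr (leb _).
by apply/seteqP; split=> y /=; rewrite !in_itv/= => /andP[]; lra.
Qed.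

Lemma normal_prob_shift (m s x : R) (B : set mR) : s != 0 -> measurable B ->
  normal_prob m s [set y | B (x + y)] = normal_prob (x + m) s B.
Proof.
move=> s0 mB; rewrite /normal_prob.
pose phi : {mfun mR >-> mR} := HB.pack (fun y : mR => x + y : mR)
  (isMeasurableFun.Build _ _ _ _ _ (measurable_addl x)).
have mpdf : measurable_fun setT (fun y : mR => (normal_pdf (x + m) s y)%:E).
  by apply/measurable_EFinP; exact: measurable_normal_pdf.
transitivity (\int[pushforward leb phi]_(y in B) (normal_pdf (x + m) s y)%:E)%E.
  rewrite ge0_integral_pushforward//=; last 3 first.
  - exact: measurable_addl.
  - exact: measurable_funTS.
  - by move=> y _; rewrite lee_fin normal_pdf_ge0.
  apply: eq_integral => y _ /=; congr EFin.
  rewrite !normal_pdfE//= /normal_fun; do 5 f_equal; ring.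
apply: eq_measure_integral => A mA _.
exact: (esym (lebesgue_measure_shift x _ mA)).
Qed.

Lemma gauss_prob_shift (m v x : R) (B : set mR) : 0 <= v -> measurable B ->
  gauss_prob m v [set y | B (x + y)] = gauss_prob (x + m) v B.
Proof.
move=> v0 mB; rewrite /gauss_prob; have [//|vn0] := eqVneq v 0.
rewrite /= normal_prob_shift// gt_eqF// sqrtr_gt0 lt_neqAle v0 andbT eq_sym.
exact: vn0.
Qed.

(** The normal density is a version of the Radon-Nikodym derivative: both have the same integral
    over every measurable set, so they agree almost everywhere. *)
Lemma integral_normal_prob (m s : R) (f : mR -> \bar R) :
  (normal_prob m s).-integrable setT f ->
  (\int[normal_prob m s]_x f x = \int[leb]_x (f x * (normal_pdf m s x)%:E))%E.
Proof.
move=> intf; have [mf _] := integrableP _ _ _ intf.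
have mpdf : measurable_fun setT (fun y : mR => (normal_pdf m s y)%:E).
  by apply/measurable_EFinP; exact: measurable_normal_pdf.
rewrite -(Radon_Nikodym_change_of_variables (normal_prob_dominates m s))//=.
apply: ae_eq_integral => //.
- apply: emeasurable_funM => //; apply: (measurable_int leb).
  by apply: Radon_Nikodym_integrable; exact: normal_prob_dominates.
- exact: emeasurable_funM.
- apply: ae_eqe_mul2l => /=.
  rewrite Radon_NikodymE//=; first exact: normal_prob_dominates.
  move=> abmu; case: cid => /= h [h1 h2 h3].
  by apply: integral_ae_eq => //= E _ mE; rewrite -h3.
Qed.

(* Completing the square in x: the second factor on the right is a probability
   density in x, so integrating x out gives the convolution. *)
Lemma normal_pdf_conv (m1 s1 m2 s2 s x z : R) : s1 != 0 -> s2 != 0 ->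
  0 < s -> s ^+ 2 = s1 ^+ 2 + s2 ^+ 2 ->
  normal_pdf (x + m2) s2 z * normal_pdf m1 s1 x =
  normal_pdf (m1 + m2) s z *
  normal_pdf (m1 + s1 ^+ 2 * (z - m1 - m2) / s ^+ 2) (s1 * s2 / s) x.
Proof.
move=> s10 s20 sgt0 sE.
have s0 : s != 0 by rewrite gt_eqF.
have ss0 : s1 ^+ 2 + s2 ^+ 2 != 0 by rewrite -sE expf_neq0.
have s'0 : s1 * s2 / s != 0 by rewrite !mulf_neq0// invr_eq0.
rewrite !normal_pdfE//.
rewrite mulrACA [RHS]mulrACA; congr (_ * _).
  rewrite /normal_peak -!invfM; congr (_^-1).
  rewrite -!sqrtrM; try (by rewrite mulrn_wge0// mulr_ge0 ?sqr_ge0 ?pi_ge0).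
  by congr Num.sqrt; move: (pi : R) => p; field.
rewrite /normal_fun -!expRD; congr expR.
rewrite expr_div_n exprMn sE; field.
by rewrite s10 s20 ss0.
Qed.

Lemma measurable_normal_pdf2 (m s : R) : s != 0 ->
  measurable_fun setT (fun p : mR * mR => normal_pdf (p.1 + m) s p.2).
Proof.
move=> s0.
have -> : (fun p : mR * mR => normal_pdf (p.1 + m) s p.2) =
          normal_pdf m s \o (fun p : mR * mR => p.2 - p.1 : mR).
  apply/funext => -[a b] /=; rewrite !normal_pdfE// /normal_fun.
  do 5 f_equal; ring.
apply: measurableT_comp; first exact: measurable_normal_pdf.
exact: measurable_funB.
Qed.

Lemma normal_prob_conv (m1 s1 m2 s2 s : R) (B : set mR) : s1 != 0 -> s2 != 0 ->
  0 < s -> s ^+ 2 = s1 ^+ 2 + s2 ^+ 2 -> measurable B ->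
  (\int[normal_prob m1 s1]_x normal_prob m2 s2 [set y | B (x + y)%R] =
   normal_prob (m1 + m2)%R s B)%E.
Proof.
move=> s10 s20 sgt0 sE mB.
(* The second variable stands for the value of the sum, so its law given [x] is centred at
   [x + m2]. *)
pose g (p : mR * mR) : \bar R :=
  ((\1_B p.2)%:E * (normal_pdf (p.1 + m2) s2 p.2)%:E)%E.
have mg : measurable_fun setT g.
  apply: emeasurable_funM; apply/measurable_EFinP.
    by apply: measurableT_comp => //; exact: measurable_indic.
  exact: measurable_normal_pdf2.
have g0 p : (0 <= g p)%E.
  by rewrite mule_ge0// lee_fin ?normal_pdf_ge0// indicE ler0n.
have gE x : (\int[leb]_z g (x, z) = normal_prob m2 s2 [set y | B (x + y)%R])%E.
  rewrite normal_prob_shift// /normal_prob [RHS]integral_mkcond.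
  apply: eq_integral => z _; rewrite /g/= /patch indicE.
  by case: ifPn => _; rewrite ?mul1e ?mul0e.
have mG : measurable_fun setT (fun x : mR => \int[leb]_z g (x, z))%E.
  exact: measurable_fun_fubini_tonelli_F.
transitivity (\int[normal_prob m1 s1]_x \int[leb]_z g (x, z))%E.
  by apply: eq_integral => x _; rewrite gE.
(* Integrability: the integrand is a probability, hence at most 1, under a probability measure. *)
rewrite integral_normal_prob; last first.
  apply/integrableP; split => //.
  apply: (@le_lt_trans _ _ (\int[normal_prob m1 s1]_x (cst 1 x))%E).
    apply: ge0_le_integral => //.
      exact: measurableT_comp.
    move=> x _; rewrite gee0_abs ?integral_ge0// gE; apply: probability_le1.
    by rewrite -[X in measurable X]setTI; exact: (measurable_addl x).
  rewrite integral_cst//=.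
  have /= -> := @probability_setT _ _ _ (normal_prob m1 s1 : probability mR R).
  by rewrite mule1 ltry.
pose h (p : mR * mR) : \bar R := (g p * (normal_pdf m1 s1 p.1)%:E)%E.
have mh : measurable_fun setT h.
  apply: emeasurable_funM => //; apply/measurable_EFinP.
  by apply: measurableT_comp => //; exact: measurable_normal_pdf.
have h0 p : (0 <= h p)%E by rewrite mule_ge0// lee_fin normal_pdf_ge0.
transitivity (\int[leb]_x \int[leb]_z h (x, z))%E.
  apply: eq_integral => x _; rewrite -ge0_integralZr//.
  - exact: measurable_comp mg _.
  - by rewrite lee_fin normal_pdf_ge0.
(* Integrating over [x] first leaves, for each [z], the density of the sum times the total mass of a
   normal density in [x]. *)
rewrite fubini_tonelli// /normal_prob [RHS]integral_mkcond.
apply: eq_integral => z _; rewrite /patch; case: ifPn => zB; last first.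
  by apply: integral0_eq => x _; rewrite /h /g/= indicE (negbTE zB) !mul0e.
transitivity (\int[leb]_x ((normal_pdf (m1 + m2) s z)%:E *
  (normal_pdf (m1 + s1 ^+ 2 * (z - m1 - m2) / s ^+ 2) (s1 * s2 / s) x)%:E))%E.
  apply: eq_integral => x _; rewrite /h /g/= indicE zB mul1e -!EFinM.
  by congr EFin; exact: normal_pdf_conv.
rewrite ge0_integralZl//.
- by rewrite integral_normal_pdf mule1.
- by apply/measurable_EFinP; exact: measurable_normal_pdf.
- by move=> x _; rewrite lee_fin normal_pdf_ge0.
- by rewrite lee_fin normal_pdf_ge0.
Qed.

Lemma sqrtr_neq0 (v : R) : 0 <= v -> v != 0 -> Num.sqrt v != 0.
Proof. by move=> v0 vn0; rewrite gt_eqF// sqrtr_gt0 lt_neqAle v0 andbT eq_sym. Qed.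

(** If either law is a point mass, the convolution is a translation of the other; only two positive
    variances need densities. *)
Lemma gauss_prob_conv (m1 v1 m2 v2 : R) (B : set mR) : 0 <= v1 -> 0 <= v2 ->
  measurable B ->
  (\int[gauss_prob m1 v1]_x gauss_prob m2 v2 [set y | B (x + y)%R] =
   gauss_prob (m1 + m2)%R (v1 + v2)%R B)%E.
Proof.
move=> v10 v20 mB.
have mD : measurable [set p : mR * mR | B (p.1 + p.2)].
  rewrite -[X in measurable X]setTI.
  by apply: (measurable_funD measurable_fst measurable_snd).
have mF : measurable_fun setT
    (fun x : mR => gauss_prob m2 v2 [set y | B (x + y)]).
  apply: eq_measurable_fun (measurable_fun_xsection (gauss_prob m2 v2) mD).
  by move=> x _ /=; congr (gauss_prob _ _ _); apply/seteqP;
    split=> y; rewrite /xsection/= inE.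
have [v1E|v1n0] := eqVneq v1 0.
  rewrite v1E {1}/gauss_prob eqxx integral_dirac//= diracT mul1e add0r.
  by rewrite gauss_prob_shift.
have [v2E|v2n0] := eqVneq v2 0.
  rewrite v2E addr0 {2}/gauss_prob eqxx.
  transitivity (\int[gauss_prob m1 v1]_x
     (\1_[set x : mR | B (m2 + x)] x)%:E)%E.
    apply: eq_integral => x _; rewrite indicE/= diracE; congr (_%:R%:E).
    by congr nat_of_bool; apply/idP/idP; rewrite !inE/= addrC.
  rewrite integral_indic//; last first.
    by rewrite -[X in measurable X]setTI; exact: (measurable_addl m2).
  by rewrite setIT (addrC m1); exact: gauss_prob_shift.
rewrite /gauss_prob (negbTE v1n0) (negbTE v2n0) paddr_eq0//.
rewrite (negbTE v1n0)/=; apply: normal_prob_conv => //.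
- exact: sqrtr_neq0.
- exact: sqrtr_neq0.
- by rewrite sqrtr_gt0 ltr_pwDl// lt_neqAle v10 andbT eq_sym.
- by rewrite !sqr_sqrtr// addr_ge0.
Qed.

Lemma normal_peak_inj (s1 s2 : R) : s1 != 0 -> s2 != 0 ->
  normal_peak s1 = normal_peak s2 -> s1 ^+ 2 = s2 ^+ 2.
Proof.
move=> s10 s20 /invr_inj /eqP.
rewrite eqr_sqrt; try by rewrite mulrn_wge0// mulr_ge0 ?sqr_ge0 ?pi_ge0.
move=> /eqP h; apply: (mulIf (lt0r_neq0 (pi_gt0 R))); move: h.
by move: (pi : R) => p h; lra.
Qed.

(* The maximum of the density determines the variance, its location the mean. *)
Lemma normal_pdf_inj (m1 s1 m2 s2 : R) : s1 != 0 -> s2 != 0 ->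
  normal_pdf m1 s1 = normal_pdf m2 s2 -> m1 = m2 /\ s1 ^+ 2 = s2 ^+ 2.
Proof.
move=> s10 s20 e.
have peakE (m s : R) : s != 0 -> normal_pdf m s m = normal_peak s.
  by move=> s0; rewrite normal_pdfE// /normal_fun subrr expr0n oppr0 mul0r expR0 mulr1.
have pE : normal_peak s1 = normal_peak s2.
  apply/eqP; rewrite eq_le -{1}(peakE m1 s1)// {1}e normal_pdf_ub//=.
  by rewrite -(peakE m2 s2)// -e normal_pdf_ub.
split; last exact: normal_peak_inj.
have := peakE m1 s1 s10; rewrite e pE normal_pdfE// -{2}[normal_peak s2]mulr1.
move/(mulfI (lt0r_neq0 (normal_peak_gt0 s20))); rewrite /normal_fun -expR0.
move/expR_inj/eqP; rewrite mulf_eq0 oppr_eq0 sqrf_eq0 subr_eq0 invr_eq0.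
by rewrite mulrn_eq0/= sqrf_eq0 (negbTE s20) orbF => /eqP.
Qed.

(** Equal laws have densities equal almost everywhere. By continuity, a point where they differ has
    a ball around it where they differ, and a ball is not a null set. *)
Lemma normal_prob_inj (m1 s1 m2 s2 : R) : s1 != 0 -> s2 != 0 ->
  (forall B : set mR, measurable B -> normal_prob m1 s1 B = normal_prob m2 s2 B) ->
  m1 = m2 /\ s1 ^+ 2 = s2 ^+ 2.
Proof.
move=> s10 s20 e; apply: normal_pdf_inj => //.
have : ae_eq leb setT (EFin \o normal_pdf m1 s1) (EFin \o normal_pdf m2 s2).
  apply: integral_ae_eq.
  - exact: measurableT.
  - exact: integrable_normal_pdf.
  - by apply/measurable_EFinP; exact: measurable_normal_pdf.
  - by move=> E _; exact: e.
move=> -[N [mN N0 sN]]; apply/funext => x; apply/eqP/negPn/negP => neq.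
have : \forall y \near x, normal_pdf m1 s1 y != normal_pdf m2 s2 y.
  have c1 := @continuous_normal_pdf _ m1 _ s10.
  have c2 := @continuous_normal_pdf _ m2 _ s20.
  have c : continuous (fun y => normal_pdf m1 s1 y - normal_pdf m2 s2 y).
    by move=> y; apply: cvgB; [exact: c1|exact: c2].
  have : \forall y \near x, normal_pdf m1 s1 y - normal_pdf m2 s2 y != 0.
    by apply: (cvgr_neq0 _ (c x)); rewrite subr_eq0.
  by apply: filterS => y; rewrite subr_eq0.
move=> /nbhs_ballP[e0 /= e0gt0 he].
have : (leb (ball x e0) <= 0%:E)%E.
  apply: (@le_trans _ _ (leb N)); last by rewrite N0.
  apply: le_measure; rewrite ?inE//; first exact: measurable_ball.
  by move=> y /he /eqP hy; apply: sN => /= /(_ I) -[]; exact: hy.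
rewrite (lebesgue_measure_ball x (ltW e0gt0)) lee_fin => h.
have : 0 < e0 *+ 2 by rewrite mulrn_wgt0.
by rewrite ltNge h.
Qed.

(** Singletons tell a point mass from a nondegenerate law, which gives them probability zero, and
    from another point mass. *)
Lemma gauss_prob_inj (m1 v1 m2 v2 : R) : 0 <= v1 -> 0 <= v2 ->
  (forall B : set mR, measurable B -> gauss_prob m1 v1 B = gauss_prob m2 v2 B) ->
  m1 = m2 /\ v1 = v2.
Proof.
have normal1 m s (x : R) : normal_prob m s [set x] = 0%E.
  have /null_content_dominatesP := normal_prob_dominates m s.
  by apply; [exact: measurable_set1|exact: lebesgue_measure_set1].
have dirac1 (a b : R) : @dirac _ mR a R [set b] = (a == b)%:R%:E.
  by rewrite diracE; congr (_%:R%:E); congr nat_of_bool; apply/idP/eqP; rewrite inE.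
rewrite /gauss_prob; have [-> _|v1n0 v10] := eqVneq v1 0;
    have [-> _|v2n0 v20] := eqVneq v2 0 => e.
- split=> //; have /= := e [set m2] (measurable_set1 _).
  rewrite !dirac1 eqxx; case: eqP => // _ /(congr1 fine)/=/eqP.
  by rewrite eq_sym oner_eq0.
- have /= := e [set m1] (measurable_set1 _).
  by rewrite normal1 dirac1 eqxx => /(congr1 fine)/=/eqP; rewrite oner_eq0.
- have /= := e [set m2] (measurable_set1 _).
  by rewrite normal1 dirac1 eqxx => /(congr1 fine)/=/eqP; rewrite eq_sym oner_eq0.
- have [-> ] := normal_prob_inj _ _ _ _ (sqrtr_neq0 _ v10 v1n0) (sqrtr_neq0 _ v20 v2n0) e.
  by rewrite !sqr_sqrtr.
Qed.

End gauss.

(** * Sums of independent Gaussian variables *)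

Section indep_sum.
Context {R : realType} {d : measure_display} {T : measurableType d}.
Context (P : probability T R).
Local Notation mR := (measurableTypeR R).
Context (I : eqType) (Z : I -> T -> R) (m v : I -> R).
Hypothesis mZ : forall k, measurable_fun setT (Z k : T -> mR).
Hypothesis v_ge0 : forall k, 0 <= v k.
Hypothesis Zlaw : forall k (B : set mR), measurable B ->
  P [set w | B (Z k w)] = gauss_prob (m k) (v k) B.
Hypothesis Zindep : forall (s : seq I) (B : I -> set mR), uniq s ->
  (forall k, measurable (B k)) ->
  P [set w | forall k, k \in s -> B k (Z k w)] =
  (\prod_(k <- s) P [set w | B k (Z k w)])%E.

Let measurable_events (s : seq I) (B : I -> set mR) :
  (forall k, measurable (B k)) ->
  measurable [set w | forall k, k \in s -> B k (Z k w)].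
Proof.
move=> mB; elim: s => [|k s IHs].
  by rewrite (_ : [set _ | _] = setT)//; apply/seteqP; split.
rewrite (_ : [set _ | _] = (Z k @^-1` B k) `&`
   [set w | forall i, i \in s -> B i (Z i w)]).
  by apply: measurableI => //; rewrite -[X in measurable X]setTI; exact: mZ.
apply/seteqP; split => w /=.
  by move=> h; split; [apply: h; rewrite mem_head|move=> i si; apply: h; rewrite inE si orbT].
by move=> [h1 h2] i; rewrite inE => /orP[/eqP->//|]; exact: h2.
Qed.

(* The extra events indexed by s' carry the independence of the partial sum from
   the remaining variables through the induction on s. *)
Lemma indep_gauss_sum_joint (s s' : seq I) (B : set mR) (B' : I -> set mR) :
  uniq (s ++ s') -> measurable B -> (forall k, measurable (B' k)) ->
  P [set w | B (\sum_(k <- s) Z k w) /\ forall k, k \in s' -> B' k (Z k w)] =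
  (gauss_prob (\sum_(k <- s) m k)%R (\sum_(k <- s) v k)%R B *
   P [set w | forall k, k \in s' -> B' k (Z k w)])%E.
Proof.
elim: s s' B B' => [|k s IHs] s' B B' us mB mB'.
  rewrite !big_nil /gauss_prob eqxx/= diracE.
  have [B0|nB0] := pselect (B 0).
    rewrite mem_set// mul1e; congr (P _); apply/seteqP; split => w /=.
      by case.
    by rewrite big_nil.
  rewrite memNset// mul0e [X in P X](_ : _ = set0) ?measure0//.
  by apply/seteqP; split => w //= []; rewrite big_nil.
set E := [set w | forall k, k \in s' -> B' k (Z k w)].
have mE : measurable E by exact: measurable_events.
move: us; rewrite cat_cons /= => /andP[]; rewrite mem_cat negb_or => /andP[ks ks'] us.
have us' : uniq s' by move: us; rewrite cat_uniq => /and3P[].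
pose X : T -> mR := Z k; pose Y : T -> mR := fun w => \sum_(i <- s) Z i w.
have mX : measurable_fun setT X by exact: mZ.
have mY : measurable_fun setT Y by apply: measurable_sum => i; exact: mZ.
pose XY w := (X w, Y w).
have mXY : measurable_fun setT XY by apply/measurable_fun_pairP.
pose D : set (mR * mR) := [set p | B (p.1 + p.2)].
have mD : measurable D.
  rewrite -[X in measurable X]setTI.
  by apply: (measurable_funD measurable_fst measurable_snd).
have -> : [set w | B (\sum_(i <- k :: s) Z i w) /\
    forall i, i \in s' -> B' i (Z i w)] = XY @^-1` D `&` E.
  by apply/seteqP; split => w; rewrite /= big_cons.
have mXYD : measurable (XY @^-1` D).
  by rewrite -[X in measurable X]setTI; exact: mXY.
(* A null [E] makes both sides vanish; otherwise one can condition on [E]. *)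
have [PE0|PE0] := eqVneq (P E) 0%E.
  rewrite PE0 mule0; apply/eqP; rewrite eq_le measure_ge0 andbT -PE0.
  by apply: le_measure; rewrite ?inE//; exact: measurableI.
have finE : P E \is a fin_num by exact: fin_num_measure.
have fE0 : 0 < fine (P E).
  by rewrite fine_gt0// lt_neqAle eq_sym PE0 measure_ge0 /= ltey_eq finE.
(* [mu] is the law of the pair [XY] conditioned on [E]: restriction, pushforward, then division by
   [P E]. *)
pose kap : {nonneg R} := NngNum (ltW (etrans (invr_gt0 _) fE0)).
pose mu0 : {measure set (mR * mR) -> \bar R} :=
  mscale kap (pushforward (mrestr P mE) XY).
pose mu := mu0 mXY.
have muE D' : mu D' = ((fine (P E))^-1%:E * P (XY @^-1` D' `&` E))%E by [].
have mu_prod A1 A2 : measurable A1 -> measurable A2 ->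
    mu (A1 `*` A2) = (gauss_prob (m k) (v k) A1 *
      gauss_prob (\sum_(i <- s) m i)%R (\sum_(i <- s) v i)%R A2)%E.
  move=> mA1 mA2; rewrite muE.
  (* The event on the new variable joins the extra events, so the induction hypothesis for [k :: s']
     splits off the partial sum. *)
  pose B'' i := if i == k then A1 else B' i.
  have mB'' i : measurable (B'' i) by rewrite /B''; case: ifP.
  have E' : [set w | forall i, i \in k :: s' -> B'' i (Z i w)] = X @^-1` A1 `&` E.
    apply/seteqP; split => w /=.
      move=> h; split; first by have := h k (mem_head _ _); rewrite /B'' eqxx.
      move=> i si; have := h i; rewrite inE si orbT /B'' => /(_ isT).
      by case: eqP => // ik; move: ks'; rewrite -ik si.
    move=> [h1 h2] i; rewrite inE /B''; case: eqP => [->//|_] /=.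
    exact: h2.
  have := IHs (k :: s') A2 B'' _ mA2 mB''.
  rewrite E' => h.
  have {h} -> : P (XY @^-1` (A1 `*` A2) `&` E) =
     (gauss_prob (\sum_(i <- s) m i) (\sum_(i <- s) v i) A2 * P (X @^-1` A1 `&` E))%E.
    rewrite -h; last first.
      by rewrite (uniq_catCA s [:: k] s')/= mem_cat negb_or ks ks' us.
    congr (P _); rewrite [RHS](_ : _ = [set w | A2 (Y w)] `&`
      [set w | forall i, i \in k :: s' -> B'' i (Z i w)])// E'.
    by apply/seteqP; split => w /=; tauto.
  have -> : P (X @^-1` A1 `&` E) = (gauss_prob (m k) (v k) A1 * P E)%E.
    rewrite -E' Zindep//=; last by rewrite ks'.
    rewrite big_cons {1}/B'' eqxx Zlaw//; congr (_ * _)%E.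
    rewrite /E Zindep//; apply: eq_big_seq => i si; rewrite /B''.
    by case: eqP => // ik; move: ks'; rewrite -ik si.
  rewrite muleCA (muleC (gauss_prob (m k) (v k) A1) (P E)) (muleA _ (P E)).
  by rewrite -{2}(fineK finE) -EFinM mulVf ?gt_eqF// mul1e muleC.
(* Agreement on rectangles makes [mu] the product law; its value on [D] is a convolution
   integral. *)
have := product_measure_unique mu_prod mD.
rewrite muE /product_measure1 => h.
rewrite !big_cons -gauss_prob_conv//; last exact: sumr_ge0.
transitivity ((fine (P E))%:E * ((fine (P E))^-1%:E * P (XY @^-1` D `&` E)))%E.
  by rewrite muleA -EFinM mulfV ?gt_eqF// mul1e.
rewrite -h muleC fineK//; congr (_ * _)%E.
apply: eq_integral => x _ /=; congr (gauss_prob _ _ _).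
by apply/seteqP; split=> y; rewrite /xsection/= inE.
Qed.

Lemma indep_gauss_sum (s : seq I) (B : set mR) : uniq s -> measurable B ->
  P [set w | B (\sum_(k <- s) Z k w)] =
  gauss_prob (\sum_(k <- s) m k) (\sum_(k <- s) v k) B.
Proof.
move=> us mB.
have := @indep_gauss_sum_joint s [::] B (fun=> setT).
rewrite cats0 => /(_ us mB (fun=> measurableT)).
rewrite [X in (_ * P X)%E](_ : _ = setT); last by apply/seteqP; split.
rewrite probability_setT mule1 => <-; congr (P _).
by apply/seteqP; split => w //= [].
Qed.

End indep_sum.

(** * The Cramer-Wold theorem *)

Section sign_approx.
Context {R : realType}.

(* Iterating this map from a point of [-1, 1] converges to the sign of that
   point; 1 and -1 are attracting fixed points and 0 a repelling one. *)
Definition sign_step (s : R) : R := (3 * s - s ^+ 3) / 2.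

Lemma sign_step_itv (s : R) : `|s| <= 1 -> `|sign_step s| <= 1.
Proof.
rewrite !ler_norml /sign_step => /andP[h1 h2].
have e1 : 1 - (3 * s - s ^+ 3) / 2 = (1 - s) ^+ 2 * ((2 + s) / 2) by field.
have e2 : (3 * s - s ^+ 3) / 2 - -1 = (1 + s) ^+ 2 * ((2 - s) / 2) by field.
by apply/andP; split; rewrite -subr_ge0 ?e1 ?e2 mulr_ge0 ?sqr_ge0//; lra.
Qed.

Lemma iter_sign_step_itv n (s : R) : `|s| <= 1 -> `|iter n sign_step s| <= 1.
Proof. by move=> s1; elim: n => //= n; exact: sign_step_itv. Qed.

Lemma iter_sign_stepN n (s : R) : iter n sign_step (- s) = - iter n sign_step s.
Proof. by elim: n => //= n ->; rewrite /sign_step; field. Qed.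

(** At an iterate [t], one step multiplies the gap to 1 by [1 - t (1 + t) / 2]. The iterates
    increase from [s], so this factor is at most [1 - s / 2]. *)
Lemma iter_sign_step_gt0 n (s : R) : 0 < s -> s <= 1 ->
  s <= iter n sign_step s <= 1 /\ 1 - iter n sign_step s <= (1 - s / 2) ^+ n.
Proof.
move=> s0 s1; elim: n => [|n [/andP[h1 h2] h3]] /=.
  by rewrite expr0 lexx s1; split=> //; lra.
set t := iter n sign_step s in h1 h2 h3 *.
have e : 1 - sign_step t = (1 - t) * (1 - t * (1 + t) / 2) by rewrite /sign_step; field.
have f : sign_step t - t = t * (1 - t) * (1 + t) / 2 by rewrite /sign_step; field.
have t1 : 0 <= 1 - t by lra.
have g : 0 <= t * (1 - t) * (1 + t) / 2 by rewrite !mulr_ge0//; lra.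
have b : `|sign_step t| <= 1 by apply: sign_step_itv; rewrite ger0_norm//; lra.
split; first by move: b; rewrite ler_norml => /andP[_ ->]; rewrite andbT; lra.
rewrite e exprSr; apply: ler_pM => //.
- have : t * t <= 1 by rewrite mulr_ile1//; lra.
  lra.
- have : 0 <= t * t by rewrite mulr_ge0//; lra.
  lra.
Qed.

Lemma cvg_iter_sign_step (s : R) : `|s| <= 1 ->
  iter n sign_step s @[n --> \oo] --> Num.sg s.
Proof.
have pos (t : R) : 0 < t -> t <= 1 -> iter n sign_step t @[n --> \oo] --> (1 : R).
  move=> t0 t1.
  have g0 : (1 - (1 - t / 2) ^+ n) @[n --> \oo] --> (1 : R).
    rewrite -[X in _ --> X]subr0; apply: cvgB; first exact: cvg_cst.
    by apply: cvg_expr; rewrite ger0_norm; lra.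
  apply: (squeeze_cvgr _ g0 (cvg_cst _)).
  by near=> n; have [/andP[_ ->]] := iter_sign_step_gt0 n t t0 t1; rewrite andbT; lra.
move=> s1; have [s0|s0|->] := ltgtP s 0.
- rewrite ltr0_sg//.
  have -> : (fun n => iter n sign_step s) = (fun n => - iter n sign_step (- s)).
    by apply/funext => n; rewrite iter_sign_stepN opprK.
  by apply: cvgN; apply: pos; move: s1; rewrite ?ltr0_norm//; lra.
- by rewrite gtr0_sg//; apply: pos; move: s1; rewrite ?gtr0_norm//; lra.
- rewrite sgr0 [X in X @ _ --> _](_ : _ = cst 0); first exact: cvg_cst.
  by apply/funext; elim=> //= n ->; rewrite /sign_step; field.
Unshelve. all: by end_near. Qed.

(** The outer polynomial sends -1 and 0 to 0 and 1 to 1, so the limit is the strict step, with value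
    0 at the origin. *)
Definition step_approx n (s : R) : R := (iter n sign_step s ^+ 2 + iter n sign_step s) / 2.

Lemma step_approx_itv n (s : R) : `|s| <= 1 -> `|step_approx n s| <= 1.
Proof.
move=> /(iter_sign_step_itv n); rewrite /step_approx; move: (iter n sign_step s) => t.
by rewrite !ler_norml => /andP[h1 h2]; apply/andP; split; nra.
Qed.

Lemma cvg_step_approx (s : R) : `|s| <= 1 -> step_approx n s @[n --> \oo] --> ((0 < s)%R%:R : R).
Proof.
move=> /cvg_iter_sign_step h.
have -> : (0 < s)%R%:R = (Num.sg s ^+ 2 + Num.sg s) / 2 :> R.
  by case: sgrP => _ /=; field.
apply: cvgM; last exact: cvg_cst.
by apply: cvgD => //; rewrite expr2; apply: cvgM.
Qed.

(** As soon as [n.+1] exceeds [|x| / pi], the rescaled point lies in the interval where sine has the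
    sign of its argument; the sequence is eventually constant. *)
Lemma cvg_sin_gt0 (x : R) :
  ((0 < sin (x / n.+1%:R))%R%:R : R) @[n --> \oo] --> ((0 < x)%R%:R : R).
Proof.
have small : \forall n \near \oo, `|x| / n.+1%:R < pi.
  near=> n; rewrite ltr_pdivrMr ?ltr0n//.
  have : `|x| / pi < n.+1%:R.
    by rewrite -natr1 ltr_wpDr//; near: n; exact: nbhs_infty_gtr.
  by rewrite ltr_pdivrMr ?pi_gt0// mulrC.
apply: cvg_near_cst; near=> n.
have hn : `|x| / n.+1%:R < pi by near: n.
have i0 : 0 < (n.+1%:R^-1 : R) by rewrite invr_gt0 ltr0n.
congr (_%:R); congr nat_of_bool.
have [x0|x0|->] := ltgtP x 0.
- apply/negbTE; rewrite -leNgt -oppr_ge0 -sinN -mulNr; apply: sin_ge0_pi.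
  by rewrite ltr0_norm// in hn; rewrite (ltW hn) andbT mulr_ge0// ltW// oppr_gt0.
- apply: sin_gt0_pi; rewrite gtr0_norm// in hn.
  by rewrite hn andbT mulr_gt0.
- by rewrite mul0r sin0 ltxx.
Unshelve. all: by end_near. Qed.

End sign_approx.

(** * The algebra of trigonometric polynomials in finitely many variables *)

Section trig_poly.
Context {R : realType} {J : finType}.

(** Each generator depends on a single linear form, so its expectation is fixed by a one-dimensional
    law. The phase [b] makes sines and constants available from cosines alone. *)
Inductive trig_poly : ((J -> R) -> R) -> Prop :=
| trig_cos (a : J -> R) (b : R) :
    trig_poly (fun x => cos (\sum_j a j * x j + b))
| trig_add f g : trig_poly f -> trig_poly g -> trig_poly (fun x => f x + g x)
| trig_scale (c : R) f : trig_poly f -> trig_poly (fun x => c * f x).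

Lemma trig_cst (c : R) : trig_poly (fun=> c).
Proof.
have := trig_scale c _ (trig_cos (fun=> 0) 0).
congr trig_poly; apply/funext => x.
by rewrite big1 ?addr0 ?cos0 ?mulr1// => j _; rewrite mul0r.
Qed.

Lemma cosM_half (a b : R) : cos a * cos b = 2^-1 * cos (a + b) + 2^-1 * cos (a - b).
Proof. by rewrite cosD cosB; field. Qed.

(** The product-to-sum formula linearizes a product of two generators; bilinearity does the rest. *)
Lemma trig_mul f g : trig_poly f -> trig_poly g -> trig_poly (fun x => f x * g x).
Proof.
move=> tf; elim: tf g => [a b|f1 f2 _ IH1 _ IH2|c f1 _ IH1] g tg.
- elim: tg => [a' b'|g1 g2 _ IH1 _ IH2|c g1 _ IH1].
  + rewrite (_ : (fun x => _) = (fun x =>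
      2^-1 * cos (\sum_j (a j + a' j) * x j + (b + b')) +
      2^-1 * cos (\sum_j (a j - a' j) * x j + (b - b')))).
      by apply: trig_add; apply: trig_scale; exact: trig_cos.
    apply/funext => x; rewrite cosM_half; congr (_ * cos _ + _ * cos _).
      rewrite addrACA -big_split/=; congr (_ + _).
      by apply: eq_bigr => j _; rewrite mulrDl.
    rewrite opprD addrACA -sumrB; congr (_ + _).
    by apply: eq_bigr => j _; rewrite mulrBl.
  + rewrite (_ : (fun x => _) = (fun x =>
      cos (\sum_j a j * x j + b) * g1 x + cos (\sum_j a j * x j + b) * g2 x)).
      exact: trig_add.
    by apply/funext => x; rewrite mulrDr.
  + rewrite (_ : (fun x => _) = (fun x =>
      c * (cos (\sum_j a j * x j + b) * g1 x))); first exact: trig_scale.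
    by apply/funext => x; rewrite mulrCA.
- rewrite (_ : (fun x => _) = (fun x => f1 x * g x + f2 x * g x)).
    by apply: trig_add; [exact: IH1|exact: IH2].
  by apply/funext => x; rewrite mulrDl.
- rewrite (_ : (fun x => _) = (fun x => c * (f1 x * g x))).
    by apply: trig_scale; exact: IH1.
  by apply/funext => x; rewrite mulrA.
Qed.

Lemma trig_sin (j : J) (c l : R) : trig_poly (fun x => sin ((x j - c) / l)).
Proof.
(* A sine is a cosine whose phase is lowered by [pi / 2]. *)
have := trig_cos (fun i => (i == j)%:R / l) (- c / l - pi / 2).
congr trig_poly; apply/funext => x.
rewrite (bigD1 j)//= eqxx big1 ?addr0; last first.
  by move=> i /negbTE ->; rewrite !mul0r.
rewrite addrA cosB cos_pihalf sin_pihalf mulr0 add0r mulr1; congr sin.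
by rewrite mul1r mulrC -mulrDl.
Qed.

Lemma trig_iter_sign_step n f : trig_poly f -> trig_poly (fun x => iter n sign_step (f x)).
Proof.
move=> tf; elim: n => //= n IH.
rewrite (_ : (fun x => _) = (fun x => 3 / 2 * iter n sign_step (f x) +
   - 2^-1 * (iter n sign_step (f x) * (iter n sign_step (f x) * iter n sign_step (f x))))).
  by apply: trig_add; apply: trig_scale => //; apply: trig_mul => //; exact: trig_mul.
by apply/funext => x; rewrite /sign_step; move: (iter n _ _) => t; field.
Qed.

Lemma trig_step_approx n f : trig_poly f -> trig_poly (fun x => step_approx n (f x)).
Proof.
move=> /(trig_iter_sign_step n) tf.
rewrite (_ : (fun x => _) = (fun x => 2^-1 * (iter n sign_step (f x) * iter n sign_step (f x)) +
   2^-1 * iter n sign_step (f x))).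
  by apply: trig_add; apply: trig_scale => //; exact: trig_mul.
by apply/funext => x; rewrite /step_approx; field.
Qed.

Lemma trig_prod (s : seq J) (f : J -> (J -> R) -> R) :
  (forall j, trig_poly (f j)) -> trig_poly (fun x => \prod_(j <- s) f j x).
Proof.
move=> tf; elim: s => [|j s IH].
  by rewrite (_ : (fun x => _) = fun=> 1); [exact: trig_cst|apply/funext => x; rewrite big_nil].
rewrite (_ : (fun x => _) = fun x => f j x * \prod_(i <- s) f i x).
  exact: trig_mul.
by apply/funext => x; rewrite big_cons.
Qed.

Lemma trig_bounded f : trig_poly f -> exists M : R, forall x, `|f x| <= M.
Proof.
elim=> [a b|f1 f2 _ [M1 h1] _ [M2 h2]|c f1 _ [M h]].
- by exists 1 => x; rewrite ler_norml cos_geN1 cos_le1.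
- by exists (M1 + M2) => x; rewrite (le_trans (ler_normD _ _))// lerD.
- by exists (`|c| * M) => x; rewrite normrM ler_wpM2l.
Qed.

End trig_poly.

(** * From laws of linear forms to expectations of orthant indicators *)

Section cramer_wold.
Context {R : realType} {J : finType}.
Local Notation mR := (measurableTypeR R).

Section law.
Context {d : measure_display} {T : measurableType d} (P : probability T R).
Context (X : T -> J -> R).
Hypothesis mX : forall j, measurable_fun setT (fun w => X w j : mR).

Lemma measurable_lin (a : J -> R) :
  measurable_fun setT (fun w => \sum_j a j * X w j : mR).
Proof. by apply: measurable_sum => j; apply: measurable_funM => //; exact: mX. Qed.

Lemma measurable_trig f : trig_poly f -> measurable_fun setT (fun w => f (X w) : mR).
Proof.
elim=> [a b|f1 f2 _ h1 _ h2|c f1 _ h1].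
- apply: measurableT_comp.
    by apply: continuous_measurable_fun; exact: continuous_cos.
  by apply: measurable_funD => //; exact: measurable_lin.
- exact: measurable_funD.
- exact: measurable_funM.
Qed.

Lemma integrable_bounded (g : T -> R) (M : R) : measurable_fun setT (g : T -> mR) ->
  (forall w, `|g w| <= M) -> P.-integrable setT (EFin \o g).
Proof.
move=> mg gM; apply: measurable_bounded_integrable => //; first exact: fin_num_fun_lty.
exists M; split; first exact: num_real.
by move=> x Mx w _; apply: (le_trans (gM w)); exact: ltW.
Qed.

Lemma integrable_trig f : trig_poly f -> P.-integrable setT (EFin \o (fun w => f (X w))).
Proof.
move=> tf; have [M hM] := trig_bounded _ tf.
by apply: (integrable_bounded _ M) => //; exact: measurable_trig.
Qed.

Lemma bounded_cvg_integral (fs : nat -> T -> R) (f : T -> R) :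
  (forall n, measurable_fun setT (fs n : T -> mR)) ->
  (forall n w, `|fs n w| <= 1) -> (forall w, fs n w @[n --> \oo] --> f w) ->
  measurable_fun setT (f : T -> mR) /\
  (\int[P]_w (fs n w)%:E @[n --> \oo] --> \int[P]_w (f w)%:E)%E.
Proof.
move=> mfs fs1 fsf.
have mf : measurable_fun setT (f : T -> mR).
  by apply: (measurable_fun_cvg (h := fs)) => // w _; exact: fsf.
split => //.
have [] := @dominated_convergence _ _ _ P setT measurableT
  (fun n w => (fs n w)%:E) (fun w => (f w)%:E) (cst 1%E).
- by move=> n; exact/measurable_EFinP/mfs.
- exact/measurable_EFinP.
- by apply: aeW => w _; apply: cvg_EFin; [exact: nearW|exact: fsf].
- by apply: finite_measure_integrable_cst.
- by apply: aeW => w n _ /=; rewrite lee_fin.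
by [].
Qed.

End law.

Context {d1 : measure_display} {T1 : measurableType d1} (P1 : probability T1 R).
Context {d2 : measure_display} {T2 : measurableType d2} (P2 : probability T2 R).
Context (X : T1 -> J -> R) (Y : T2 -> J -> R).
Hypothesis mX : forall j, measurable_fun setT (fun w => X w j : mR).
Hypothesis mY : forall j, measurable_fun setT (fun w => Y w j : mR).
Hypothesis XY_lin : forall (a : J -> R) (B : set mR), measurable B ->
  P1 [set w | B (\sum_j a j * X w j)] = P2 [set w | B (\sum_j a j * Y w j)].

(** Measurability is bundled with the equality of expectations so that the whole property passes to
    bounded pointwise limits. *)
Definition same_mean (F : (J -> R) -> R) : Prop :=
  [/\ measurable_fun setT (fun w => F (X w) : mR),
      measurable_fun setT (fun w => F (Y w) : mR) &
      (\int[P1]_w (F (X w))%:E = \int[P2]_w (F (Y w))%:E)%E].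

Lemma same_mean_lim (Fs : nat -> (J -> R) -> R) F :
  (forall n, same_mean (Fs n)) -> (forall n x, `|Fs n x| <= 1) ->
  (forall x, Fs n x @[n --> \oo] --> F x) -> same_mean F.
Proof.
move=> sFs Fs1 FsF.
have [m1 c1] := @bounded_cvg_integral _ _ P1 (fun n w => Fs n (X w)) (fun w => F (X w))
  (fun n => let: And3 h _ _ := sFs n in h) (fun n w => Fs1 n (X w)) (fun w => FsF (X w)).
have [m2 c2] := @bounded_cvg_integral _ _ P2 (fun n w => Fs n (Y w)) (fun w => F (Y w))
  (fun n => let: And3 _ h _ := sFs n in h) (fun n w => Fs1 n (Y w)) (fun w => FsF (Y w)).
split => //; rewrite -(cvg_lim _ c1)// -(cvg_lim _ c2)//.
by apply/congr_lim/funext => n; have [] := sFs n.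
Qed.

(** Both integrals are transported to the real line, where the laws of the two linear forms
    coincide. *)
Lemma same_mean_cos (a : J -> R) (b : R) :
  (\int[P1]_w (cos (\sum_j a j * X w j + b))%:E =
   \int[P2]_w (cos (\sum_j a j * Y w j + b))%:E)%E.
Proof.
pose Z1 w : mR := \sum_j a j * X w j; pose Z2 w : mR := \sum_j a j * Y w j.
have mZ1 : measurable_fun setT Z1 := measurable_lin _ mX a.
have mZ2 : measurable_fun setT Z2 := measurable_lin _ mY a.
pose f (z : mR) : \bar R := (cos (z + b))%:E.
have mcos : measurable_fun setT (fun z : mR => cos (z + b) : mR).
  apply: measurableT_comp; last exact: measurable_funD.
  by apply: continuous_measurable_fun; exact: continuous_cos.
have mf : measurable_fun setT f by apply/measurable_EFinP.
have int1 : P1.-integrable (Z1 @^-1` setT) (f \o Z1).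
  apply: (integrable_bounded P1 (fun w => cos (Z1 w + b)) 1).
    exact: measurable_comp mcos mZ1.
  by move=> w; rewrite ler_norml cos_geN1 cos_le1.
have int2 : P2.-integrable (Z2 @^-1` setT) (f \o Z2).
  apply: (integrable_bounded P2 (fun w => cos (Z2 w + b)) 1).
    exact: measurable_comp mcos mZ2.
  by move=> w; rewrite ler_norml cos_geN1 cos_le1.
transitivity (\int[pushforward P1 Z1]_z f z)%E.
  by rewrite integral_pushforward.
transitivity (\int[pushforward P2 Z2]_z f z)%E; last by rewrite integral_pushforward.
by apply: eq_measure_integral => B mB _; exact: XY_lin.
Qed.

Lemma same_mean_trig f : trig_poly f -> same_mean f.
Proof.
move=> tf; split; [exact: measurable_trig|exact: measurable_trig|].
elim: tf => [a b|f1 f2 tf1 h1 tf2 h2|c f1 tf1 h1].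
- exact: same_mean_cos.
- under eq_integral do rewrite EFinD.
  under [RHS]eq_integral do rewrite EFinD.
  rewrite !integralD//; try exact: integrable_trig.
  by rewrite h1 h2.
- under eq_integral do rewrite EFinM.
  under [RHS]eq_integral do rewrite EFinM.
  rewrite !integralZl//; try exact: integrable_trig.
  by rewrite h1.
Qed.

(** [None] leaves a coordinate free, so the whole space and the half-spaces in one coordinate are
    orthants too. *)
Definition orthant (c : J -> option R) : set (J -> R) :=
  [set x | forall j, if c j is Some r then r < x j else true].

Lemma cvg_prod_seq (s : seq J) (f : J -> nat -> R) (l : J -> R) :
  (forall j, f j n @[n --> \oo] --> l j) ->
  \prod_(j <- s) f j n @[n --> \oo] --> \prod_(j <- s) l j.
Proof.
move=> fl; elim: s => [|j s IH].
  rewrite big_nil [X in X @ _ --> _](_ : _ = cst 1); first exact: cvg_cst.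
  by apply/funext => n; rewrite big_nil.
rewrite big_cons [X in X @ _ --> _](_ : _ = (fun n => f j n * \prod_(i <- s) f i n)).
  exact: cvgM.
by apply/funext => n; rewrite big_cons.
Qed.

Lemma norm_prod_le1 (f : J -> R) :
  (forall j, `|f j| <= 1) -> `|\prod_j f j| <= 1.
Proof. by move=> f1; rewrite normr_prod; apply: prodr_ile1 => j; rewrite normr_ge0 f1. Qed.

(* Two successive limits: first the sign approximation inside the period of
   length proportional to n, then n to infinity. *)
Lemma same_mean_orthant c : same_mean \1_(orthant c).
Proof.
pose F n k x : R := \prod_j (if c j is Some r then step_approx k (sin ((x j - r) / n.+1%:R)) else 1).
pose G n x : R := \prod_j (if c j is Some r then (0 < sin ((x j - r) / n.+1%:R))%R%:R else 1).
have sin1 (t : R) : `|sin t| <= 1 by rewrite ler_norml sin_geN1 sin_le1.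
have sG n : same_mean (G n).
  apply: (same_mean_lim (F n)) => [k|k x|x].
  - apply: same_mean_trig; apply: trig_prod => j; case: (c j) => [r|].
      by apply: trig_step_approx; exact: trig_sin.
    exact: trig_cst.
  - apply: norm_prod_le1 => j; case: (c j) => [r|]; last by rewrite normr1.
    exact: step_approx_itv.
  - apply: cvg_prod_seq => j; case: (c j) => [r|]; last exact: cvg_cst.
    exact: cvg_step_approx.
apply: (same_mean_lim G) => // [n x|x].
  apply: norm_prod_le1 => j; case: (c j) => [r|]; last by rewrite normr1.
  by case: (0 < _); rewrite ?normr1 ?normr0.
have -> : \1_(orthant c) x =
    \prod_j (if c j is Some r then (0 < x j - r)%R%:R else 1) :> R.
  rewrite indicE; have [h|] := pselect (orthant c x).
    rewrite mem_set// big1// => j _; have := h j.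
    by case: (c j) => // r rx; rewrite subr_gt0 rx.
  move=> nh; rewrite memNset//; move/existsNP : nh => [j].
  case cj : (c j) => [r|//] /negP rx; apply/esym/eqP; rewrite prodf_seq_eq0.
  by apply/hasP; exists j; rewrite ?mem_index_enum//= cj subr_gt0 (negbTE rx).
apply: cvg_prod_seq => j; case: (c j) => [r|]; last exact: cvg_cst.
exact: cvg_sin_gt0.
Qed.

End cramer_wold.

(** * Borel sets of finite families, and equality of laws *)

Section borel_fin.
Context {R : realType} {J : finType}.
Local Notation mR := (measurableTypeR R).
Local Notation mRJ := (g_sigma_algebraType (@rects R J)).

Lemma measurable_coord (j : J) : measurable_fun setT (fun x : mRJ => x j : mR).
Proof.
move=> _ B mB; rewrite setTI; apply: sub_sigma_algebra.
exists (fun i => if i == j then B else setT) => /=.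
  by move=> i; case: ifP => _; [exact: mB|exact: measurableT].
apply/seteqP; split => x /=; first by move/(_ j); rewrite eqxx.
by move=> Bx i; case: eqP => // ->.
Qed.

Lemma borel_fin_lin (a : J -> R) (B : set mR) : measurable B ->
  borel_fin [set x : J -> R | B (\sum_j a j * x j)].
Proof.
move=> mB; have := @measurable_lin _ J _ mRJ id measurable_coord a measurableT B mB.
by rewrite setTI.
Qed.

Lemma measurable_rect {d : measure_display} {T : measurableType d}
  (X : T -> J -> R) (A : J -> set R) :
  (forall j, measurable_fun setT (fun w => X w j : mR)) ->
  (forall j, measurable (A j)) ->
  measurable [set w | forall j, A j (X w j)].
Proof.
move=> mX mA.
rewrite (_ : [set _ | _] = \bigcap_(j in [set: J]) ((fun w => X w j) @^-1` A j)).
  apply: fin_bigcap_measurable => [|j _]; first exact: finite_finset.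
  rewrite -[X in measurable X]setTI; exact: (mX j measurableT (A j) (mA j)).
by apply/seteqP; split => w h j; [move=> _; exact: h|exact: h].
Qed.

Lemma measurable_vec {d : measure_display} {T : measurableType d}
  (X : T -> J -> R) : (forall j, measurable_fun setT (fun w => X w j : mR)) ->
  measurable_fun setT (X : T -> mRJ).
Proof.
move=> mX; apply: (@measurability _ _ T mRJ setT X (@rects R J) erefl) => _ [_ [A mA <-] <-].
by rewrite setTI; exact: measurable_rect.
Qed.

(** Open upper half-lines generate the Borel sets of the line, so orthants make every coordinate,
    and hence every rectangle, measurable; conversely each orthant is a rectangle. *)
Lemma borel_fin_orthant :
  @borel_fin R J = <<s [set orthant c | c in [set: J -> option R]] >>.
Proof.
apply/seteqP; split.
  apply: smallest_sub; first exact: smallest_sigma_algebra.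
  move=> _ [A mA <-].
  apply: (@measurable_rect _
    (g_sigma_algebraType [set orthant c | c in [set: J -> option R]]) id A) => // j.
  apply: (measurability _ (RGenOInfty.measurableE R)) => // _ [_ [r ->] <-].
  rewrite setTI; apply: sub_sigma_algebra.
  exists (fun i => if i == j then Some r else None) => //.
  apply/seteqP; split => x /=; rewrite in_itv/= andbT.
    by move/(_ j); rewrite eqxx.
  by move=> rx i; case: eqP => // ->.
apply: smallest_sub; first exact: smallest_sigma_algebra.
move=> _ [c _ <-]; apply: sub_sigma_algebra.
exists (fun j => if c j is Some r then `]r, +oo[%classic else setT).
  by move=> j; case: (c j) => [r|]; [exact: measurable_itv|exact: measurableT].
by apply/seteqP; split => x h j; have := h j; case: (c j) => // r;
  rewrite /= in_itv/= andbT.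
Qed.

Lemma orthantI_closed : setI_closed [set @orthant R J c | c in [set: J -> option R]].
Proof.
move=> _ _ [c1 _ <-] [c2 _ <-].
exists (fun j => match c1 j, c2 j with
  | Some r1, Some r2 => Some (Num.max r1 r2) | Some r, None => Some r
  | None, o => o end) => //.
apply/seteqP; split => x /=.
  by move=> h; split => j; have := h j; case: (c1 j) => [r1|]; case: (c2 j) => [r2|] //;
    rewrite gt_max => /andP[].
move=> [h1 h2] j; have := h1 j; have := h2 j.
by case: (c1 j) => [r1|]; case: (c2 j) => [r2|] // a b; rewrite gt_max a b.
Qed.

(** Orthants form a generating family closed under intersection and containing the whole space, so
    it suffices that the two laws agree on them. *)
Theorem cramer_wold
  {d1 : measure_display} {T1 : measurableType d1} (P1 : probability T1 R)
  {d2 : measure_display} {T2 : measurableType d2} (P2 : probability T2 R)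
  (X : T1 -> J -> R) (Y : T2 -> J -> R) :
  (forall j, measurable_fun setT (fun w => X w j : mR)) ->
  (forall j, measurable_fun setT (fun w => Y w j : mR)) ->
  (forall (a : J -> R) (B : set mR), measurable B ->
    P1 [set w | B (\sum_j a j * X w j)] = P2 [set w | B (\sum_j a j * Y w j)]) ->
  forall B : set (J -> R), borel_fin B ->
    P1 [set w | B (X w)] = P2 [set w | B (Y w)].
Proof.
move=> mX mY XY B mB.
have vX := measurable_vec _ mX; have vY := measurable_vec _ mY.
pose m1 : {measure set mRJ -> \bar R} := pushforward P1 (X : T1 -> mRJ).
pose m2 : {measure set mRJ -> \bar R} := pushforward P2 (Y : T2 -> mRJ).
rewrite -[LHS]/(m1 vX B) -[RHS]/(m2 vY B).
apply: (@measure_unique _ R mRJ [set orthant c | c in [set: J -> option R]]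
  (fun=> setT) borel_fin_orthant orthantI_closed) => //.
- by move=> _; exists (fun=> None) => //; apply/seteqP; split.
- exact: bigcup_const.
- move=> _ [c _ <-].
  have [mo1 mo2] := same_mean_orthant P1 P2 X Y mX mY XY c.
  have mO : @measurable _ mRJ (orthant c).
    have := borel_fin_orthant; rewrite /borel_fin => h.
    by rewrite /measurable/= h; apply: sub_sigma_algebra; exists c.
  have h1 : measurable ((X : T1 -> mRJ) @^-1` orthant c).
    by rewrite -[X in measurable X]setTI; exact: vX.
  have h2 : measurable ((Y : T2 -> mRJ) @^-1` orthant c).
    by rewrite -[X in measurable X]setTI; exact: vY.
  have := @integral_indic _ _ _ P1 setT measurableT _ h1.
  have := @integral_indic _ _ _ P2 setT measurableT _ h2.
  by rewrite !setIT => e2 e1 e; rewrite /m1 /m2 /= /pushforward -e1 -e2.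
- by move=> _; rewrite /m1/= /pushforward preimage_setT probability_setT ltry.
Qed.

End borel_fin.

(** * Moving averages of Gaussian noise *)

Section noise.
Context {R : realType} {d : measure_display} {T : measurableType d}.
Context (P : probability T R).
Local Notation mR := (measurableTypeR R).
Context (l p : nat) (mu : 'cV[R]_l) (Psi : 'M[R]_p).
Context (w : nat -> T -> 'cV[R]_l) (nu : nat -> T -> 'cV[R]_p).
Hypothesis Psi_psd : forall a : 'cV[R]_p, 0 <= (a^T *m Psi *m a) 0 0.
Hypothesis noise : noise_model P mu Psi w nu.

Section coefficients.
Context (al : nat -> 'cV[R]_l) (be : nat -> 'cV[R]_p).

Let coef (k : nat + nat) : noise_dim l p k -> R :=
  match k as k0 return noise_dim l p k0 -> R with
  | inl t => fun j => al t j 0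
  | inr t => fun j => be t j 0
  end.

(** Projecting each noise vector to a scalar gives one independent Gaussian family indexed by both
    kinds of noise, to which [indep_gauss_sum] applies. *)
Let Z (k : nat + nat) (om : T) : R := \sum_j coef k j * @noise_family R d T l p w nu k om j.

Let mean (k : nat + nat) : R :=
  match k with inl t => ((al t)^T *m mu) 0 0 | inr t => 0 end.

Let var (k : nat + nat) : R :=
  match k with
  | inl t => ((al t)^T *m al t) 0 0
  | inr t => ((be t)^T *m Psi *m be t) 0 0
  end.

Lemma dotE n (a b : 'cV[R]_n) : (a^T *m b) 0 0 = \sum_j a j 0 * b j 0.
Proof. by rewrite mxE; apply: eq_bigr => j _; rewrite mxE. Qed.

Lemma quadE n (a b : 'cV[R]_n) (M : 'M[R]_n) :
  (a^T *m M *m b) 0 0 = \sum_j \sum_k a j 0 * M j k * b k 0.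
Proof.
rewrite mxE exchange_big/=; apply: eq_bigr => k _; rewrite mxE big_distrl/=.
by apply: eq_bigr => j _; rewrite mxE.
Qed.

Lemma noise_sum_law N (B : set mR) : measurable B ->
  P [set om | B (\sum_(t < N) ((al t)^T *m w t om) 0 0 +
                 \sum_(t < N) ((be t)^T *m nu t om) 0 0)] =
  gauss_prob (\sum_(t < N) ((al t)^T *m mu) 0 0)
    (\sum_(t < N) ((al t)^T *m al t) 0 0 +
     \sum_(t < N) ((be t)^T *m Psi *m be t) 0 0) B.
Proof.
move=> mB; have [mw mnu gw gnu ind] := noise.
have mfam k j : measurable_fun setT (fun om => @noise_family R d T l p w nu k om j : mR).
  by case: k j => t j; [exact: mw|exact: mnu].
have mZ k : measurable_fun setT (Z k : T -> mR).
  exact: (measurable_lin _ (mfam k)).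
have var_ge0 k : 0 <= var k.
  case: k => t /=; last exact: Psi_psd.
  by rewrite dotE sumr_ge0// => j _; rewrite -expr2 sqr_ge0.
have Zlaw k (A : set mR) : measurable A ->
    P [set om | A (Z k om)] = gauss_prob (mean k) (var k) A.
  move=> mA; rewrite -gauss_probE /Z; case: k => t /=.
    rewrite (gw t (fun j => al t j 0) A mA) dotE; congr (gauss_law _ _ _).
    by rewrite -[(al t)^T in RHS]mulmx1 quadE.
  rewrite (gnu t (fun j => be t j 0) A mA) quadE; congr (gauss_law _ _ _).
  by rewrite big1// => j _; rewrite mulr0.
have Zind (s : seq (nat + nat)) (A : nat + nat -> set mR) : uniq s ->
    (forall k, measurable (A k)) ->
    P [set om | forall k, k \in s -> A k (Z k om)] =
    (\prod_(k <- s) P [set om | A k (Z k om)])%E.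
  move=> us mA.
  (* An event on a projection is a Borel event on the noise vector itself. *)
  exact: (ind s (fun k => [set x | A k (\sum_j coef k j * x j)]) us
    (fun k => borel_fin_lin (coef k) _ (mA k))).
pose s : seq (nat + nat) := map inl (iota 0 N) ++ map inr (iota 0 N).
have us : uniq s.
  rewrite cat_uniq !map_inj_uniq ?iota_uniq; try by move=> ? ? [].
  by rewrite andbT; apply/hasPn => _ /mapP[x _ ->]; apply/negP => /mapP[].
have sumE (f : nat + nat -> R) : \sum_(k <- s) f k =
    \sum_(t < N) f (inl (t : nat)) + \sum_(t < N) f (inr (t : nat)).
  have e (g : nat -> R) : \sum_(t <- iota 0 N) g t = \sum_(t < N) g t.
    by rewrite -(big_mkord xpredT g) /index_iota subn0.
  by rewrite big_cat/= !big_map !e.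
have ZE om : \sum_(k <- s) Z k om = \sum_(t < N) ((al t)^T *m w t om) 0 0 +
    \sum_(t < N) ((be t)^T *m nu t om) 0 0.
  by rewrite sumE; congr (_ + _); apply: eq_bigr => t _; rewrite dotE.
have := @indep_gauss_sum _ _ _ P _ Z mean var mZ var_ge0 Zlaw Zind s B us mB.
rewrite !sumE/= (big1 _ _ (fun=> 0)) ?addr0// => <-; congr (P _).
by apply/seteqP; split => om /=; rewrite ZE.
Qed.

End coefficients.

Context (dd : nat -> 'cV[R]_p) (F : nat -> 'M[R]_(p, l)).

(** [F k] is the response to the process noise [k + 1] steps earlier. At [t = 0] the sum is empty,
    so the truncation in [t.-1] is harmless. *)
Definition ma_process (t : nat) (om : T) : 'cV[R]_p :=
  dd t + \sum_(tau < t) F (t.-1 - tau) *m w tau om + nu t om.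

Definition ma_mean (t : nat) : 'cV[R]_p :=
  dd t + \sum_(tau < t) F (t.-1 - tau) *m mu.

(* N only bounds the summation range: the value is the covariance of the
   process at times t and s as soon as min(t, s) <= N. *)
Definition ma_cov (N t s : nat) : 'M[R]_p :=
  \sum_(tau < N)
    (if (tau < t)%N && (tau < s)%N then F (t.-1 - tau) *m (F (s.-1 - tau))^T else 0) +
  (if t == s then Psi else 0).

Lemma measurable_ma_process t j :
  measurable_fun setT (fun om => ma_process t om j 0 : mR).
Proof.
have [mw mnu _ _ _] := noise.
rewrite (_ : (fun om => _) = (fun om => dd t j 0 +
  \sum_(tau < t) (\sum_k F (t.-1 - tau) j k * w tau om k 0) + nu t om j 0)).
  apply: measurable_funD; last exact: mnu.
  apply: measurable_funD => //; apply: measurable_sum => tau.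
  by apply: measurable_sum => k; apply: measurable_funM => //; exact: mw.
apply/funext => om; rewrite !mxE summxE; congr (_ + _ + _).
by apply: eq_bigr => tau _; rewrite mxE.
Qed.

(** The total coefficient of the process noise at time [tau] in the combination of the first [N]
    outputs with weights [c]. *)
Definition ma_gain (N : nat) (c : nat -> 'cV[R]_p) (tau : nat) : 'cV[R]_l :=
  \sum_(t < N | (tau < t)%N) (F (t.-1 - tau))^T *m c t.

Lemma ma_gain_tr N c tau : (ma_gain N c tau)^T =
  \sum_(t < N | (tau < t)%N) (c t)^T *m F (t.-1 - tau).
Proof.
by rewrite /ma_gain linear_sum/=; apply: eq_bigr => t _; rewrite trmx_mul trmxK.
Qed.

(** Interchange of summation over the triangle [tau < t]. The sequence [x] is arbitrary so as to
    cover both the noise and its mean. *)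
Lemma ma_exchange N (c : nat -> 'cV[R]_p) (x : nat -> 'cV[R]_l) :
  \sum_(t < N) ((c t)^T *m \sum_(tau < t) F (t.-1 - tau) *m x tau) 0 0 =
  \sum_(tau < N) ((ma_gain N c tau)^T *m x tau) 0 0.
Proof.
transitivity (\sum_(t < N) \sum_(tau < N | (tau < t)%N)
   ((c t)^T *m F (t.-1 - tau) *m x tau) 0 0).
  apply: eq_bigr => t _; rewrite mulmx_sumr summxE.
  rewrite (big_ord_widen_cond N xpredT
    (fun tau => ((c t)^T *m (F (t.-1 - tau) *m x tau)) 0 0)) ?(ltnW (ltn_ord t))//.
  by apply: eq_bigr => tau _; rewrite mulmxA.
rewrite (exchange_big_dep xpredT)//=; apply: eq_bigr => tau _.
by rewrite ma_gain_tr mulmx_suml summxE.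
Qed.

(** Expanding the squared gains gives a sum over [t], [s] and [tau < min(t, s)]; summing over [tau]
    first produces the covariance blocks. *)
Lemma ma_varE N (c : nat -> 'cV[R]_p) :
  \sum_(t < N) \sum_(s < N) ((c t)^T *m ma_cov N t s *m c s) 0 0 =
    \sum_(t < N) ((ma_gain N c t)^T *m ma_gain N c t) 0 0 +
    \sum_(t < N) ((c t)^T *m Psi *m c t) 0 0.
Proof.
transitivity (\sum_(t < N) \sum_(s < N)
   (\sum_(tau < N | (tau < t)%N && (tau < s)%N)
      ((c t)^T *m F (t.-1 - tau) *m ((F (s.-1 - tau))^T *m c s)) 0 0 +
    (if s == t then ((c t)^T *m Psi *m c s) 0 0 else 0))).
  apply: eq_bigr => t _; apply: eq_bigr => s _.
  rewrite /ma_cov mulmxDr mulmxDl mxE; congr (_ + _); last first.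
    by rewrite eq_sym -val_eqE; case: eqP => // _; rewrite mulmx0 mul0mx mxE.
  rewrite mulmx_sumr mulmx_suml summxE [RHS]big_mkcond/=.
  apply: eq_bigr => tau _; case: ifP => _; first by rewrite !mulmxA.
  by rewrite mulmx0 mul0mx mxE.
under eq_bigr do rewrite big_split/=.
rewrite big_split/=; congr (_ + _); last first.
  apply: eq_bigr => t _.
  by rewrite -big_mkcond big_pred1_eq.
under eq_bigr do under eq_bigr do rewrite big_mkcond.
under eq_bigr do rewrite exchange_big/=.
rewrite exchange_big/=; apply: eq_bigr => tau _.
rewrite ma_gain_tr mulmx_suml summxE [RHS]big_mkcond/=.
apply: eq_bigr => t _; case: (tau < t)%N => /=; last by rewrite big1.
by rewrite /ma_gain mulmx_sumr summxE [RHS]big_mkcond/=.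
Qed.

Lemma ma_gain_ge0 N (c : nat -> 'cV[R]_p) :
  0 <= \sum_(t < N) ((ma_gain N c t)^T *m ma_gain N c t) 0 0 +
    \sum_(t < N) ((c t)^T *m Psi *m c t) 0 0.
Proof.
apply: addr_ge0; apply: sumr_ge0 => t _ //.
by rewrite dotE sumr_ge0// => j _; rewrite -expr2 sqr_ge0.
Qed.

(** After exchanging the sums, a combination of outputs is a constant plus independent noise terms;
    the constant only shifts the Gaussian law. *)
Lemma ma_process_lin_law N (c : nat -> 'cV[R]_p) (B : set mR) : measurable B ->
  P [set om | B (\sum_(t < N) ((c t)^T *m ma_process t om) 0 0)] =
  gauss_prob (\sum_(t < N) ((c t)^T *m ma_mean t) 0 0)
    (\sum_(t < N) \sum_(s < N) ((c t)^T *m ma_cov N t s *m c s) 0 0) B.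
Proof.
move=> mB.
have linE om : \sum_(t < N) ((c t)^T *m ma_process t om) 0 0 =
    \sum_(t < N) ((c t)^T *m dd t) 0 0 +
    (\sum_(t < N) ((ma_gain N c t)^T *m w t om) 0 0 +
     \sum_(t < N) ((c t)^T *m nu t om) 0 0).
  rewrite -(ma_exchange N c (fun tau => w tau om)) -!big_split/=.
  by apply: eq_bigr => t _; rewrite /ma_process !mulmxDr !mxE addrA.
have meanE : \sum_(t < N) ((c t)^T *m ma_mean t) 0 0 =
    \sum_(t < N) ((c t)^T *m dd t) 0 0 +
    \sum_(t < N) ((ma_gain N c t)^T *m mu) 0 0.
  rewrite -(ma_exchange N c (fun=> mu)) -!big_split/=.
  by apply: eq_bigr => t _; rewrite /ma_mean !mulmxDr !mxE.
rewrite ma_varE meanE -gauss_prob_shift ?ma_gain_ge0// -noise_sum_law//.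
  by congr (P _); apply/seteqP; split => om /=; rewrite linE.
by rewrite -[X in measurable X]setTI; exact: measurable_addl.
Qed.

Lemma ma_var_ge0 N (c : nat -> 'cV[R]_p) :
  0 <= \sum_(t < N) \sum_(s < N) ((c t)^T *m ma_cov N t s *m c s) 0 0.
Proof. by rewrite ma_varE ma_gain_ge0. Qed.

End noise.

(** * Stochastic equivalence through linear combinations of outputs *)

Section stoch_equiv_lin.
Context {R : realType} (p : nat).
Local Notation mR := (measurableTypeR R).
Context {d1 : measure_display} {T1 : measurableType d1} (P1 : probability T1 R).
Context {d2 : measure_display} {T2 : measurableType d2} (P2 : probability T2 R).
Context (Y1 : nat -> T1 -> 'cV[R]_p) (Y2 : nat -> T2 -> 'cV[R]_p).

Lemma lin_combE k (a : 'I_k * 'I_p -> R) (y : 'I_k -> 'cV[R]_p) :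
  \sum_ij a ij * y ij.1 ij.2 0 =
  \sum_i ((\col_j a (i, j))^T *m y i) 0 0.
Proof.
under [RHS]eq_bigr do rewrite dotE.
rewrite pair_bigA/=; apply: eq_bigr => -[i j] _ /=.
by rewrite mxE.
Qed.

Lemma stoch_equiv_lin :
  (forall t j, measurable_fun setT (fun om => Y1 t om j 0 : mR)) ->
  (forall t j, measurable_fun setT (fun om => Y2 t om j 0 : mR)) ->
  stoch_equiv P1 Y1 P2 Y2 <->
  forall N (c : nat -> 'cV[R]_p) (B : set mR), measurable B ->
    P1 [set om | B (\sum_(t < N) ((c t)^T *m Y1 t om) 0 0)] =
    P2 [set om | B (\sum_(t < N) ((c t)^T *m Y2 t om) 0 0)].
Proof.
move=> mY1 mY2; split => [eqY N c B mB|eqY k ts B mB].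
  pose a (ij : 'I_N * 'I_p) : R := c ij.1 ij.2 0.
  have colE (i : 'I_N) : (\col_j a (i, j)) = c i by apply/colP => j; rewrite mxE.
  have E (y : nat -> 'cV[R]_p) : \sum_(t < N) ((c t)^T *m y t) 0 0 =
      \sum_ij a ij * y (nat_of_ord ij.1) ij.2 0.
    rewrite (lin_combE _ a (fun i => y i)).
    by apply: eq_bigr => t _; rewrite colE.
  have := eqY N (@nat_of_ord N) _ (borel_fin_lin a B mB).
  rewrite /= => h.
  transitivity (P1 [set om | B (\sum_ij a ij * Y1 (nat_of_ord ij.1) om ij.2 0)]).
    by congr (P1 _); apply/seteqP; split => om /=; rewrite (E (fun t => Y1 t om)).
  rewrite h.
  by congr (P2 _); apply/seteqP; split => om /=; rewrite (E (fun t => Y2 t om)).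
apply: (cramer_wold P1 P2 (fun om ij => Y1 (ts ij.1) om ij.2 0)
  (fun om ij => Y2 (ts ij.1) om ij.2 0) _ _ _ B mB) => // a {mB}B mB.
(* A horizon strictly beyond every selected time. *)
pose N := (\max_i ts i).+1.
have tsN i : (ts i < N)%N by rewrite ltnS leq_bigmax.
(* [ts] may repeat a time, so the coefficients of all indices sharing it are added up; times not
   selected get weight 0. *)
pose c t : 'cV[R]_p := \sum_(i | ts i == t) \col_j a (i, j).
have E (y : nat -> 'cV[R]_p) : \sum_ij a ij * y (ts ij.1) ij.2 0 =
    \sum_(t < N) ((c t)^T *m y t) 0 0.
  rewrite (lin_combE _ a (fun i => y (ts i))).
  rewrite (partition_big (fun i => Ordinal (tsN i)) xpredT)//=.
  apply: eq_bigr => t _; rewrite /c linear_sum/= mulmx_suml summxE.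
  by apply: eq_big => [i|i /eqP <-//]; rewrite -val_eqE.
have := eqY N c B mB.
have -> : [set om | B (\sum_(t < N) ((c t)^T *m Y1 t om) 0 0)] =
    [set om | B (\sum_ij a ij * Y1 (ts ij.1) om ij.2 0)].
  by apply/seteqP; split => om /=; rewrite (E (fun t => Y1 t om)).
have -> // : [set om | B (\sum_(t < N) ((c t)^T *m Y2 t om) 0 0)] =
    [set om | B (\sum_ij a ij * Y2 (ts ij.1) om ij.2 0)].
by apply/seteqP; split => om /=; rewrite (E (fun t => Y2 t om)).
Qed.

End stoch_equiv_lin.

(** * Recovering blocks from linear and quadratic forms *)

Section block_forms.
Context {R : realType} (p N : nat).

Let pulse (t : nat) (a : 'cV[R]_p) (s : nat) : 'cV[R]_p := if s == t then a else 0.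

Lemma block_linear_inj (y1 y2 : nat -> 'cV[R]_p) :
  (forall c : nat -> 'cV[R]_p, \sum_(t < N) ((c t)^T *m y1 t) 0 0 =
     \sum_(t < N) ((c t)^T *m y2 t) 0 0) ->
  forall t, (t < N)%N -> y1 t = y2 t.
Proof.
move=> h t tN; apply/colP => j.
have E (y : nat -> 'cV[R]_p) :
    \sum_(s < N) ((pulse t (delta_mx j 0) s)^T *m y s) 0 0 = y t j 0.
  rewrite (bigD1 (Ordinal tN))//= big1 => [|s /eqP st]; last first.
    by rewrite /pulse; case: eqP => [ts|_]; [case: st; exact: val_inj|
      rewrite trmx0 mul0mx mxE].
  by rewrite /pulse eqxx addr0 trmx_delta -rowE mxE.
by rewrite -!E h.
Qed.

Let bil (D : nat -> nat -> 'M[R]_p) (c c' : nat -> 'cV[R]_p) : R :=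
  \sum_(t < N) \sum_(s < N) ((c t)^T *m D t s *m c' s) 0 0.

(** Polarization: symmetry lets the quadratic form determine the bilinear one, and unit vectors
    placed at single times then read off each entry. *)
Lemma block_quadratic_inj (D1 D2 : nat -> nat -> 'M[R]_p) :
  (forall t s, (D1 t s)^T = D1 s t) -> (forall t s, (D2 t s)^T = D2 s t) ->
  (forall c, bil D1 c c = bil D2 c c) ->
  forall t s, (t < N)%N -> (s < N)%N -> D1 t s = D2 t s.
Proof.
move=> sym1 sym2 h t s tN sN.
have addE D c c' : (forall t s, (D t s)^T = D s t) ->
    bil D (fun t => c t + c' t) (fun t => c t + c' t) =
    bil D c c + bil D c' c' + bil D c c' *+ 2.
  move=> symD.
  have bC : bil D c' c = bil D c c'.
    rewrite /bil exchange_big/=; apply: eq_bigr => a _; apply: eq_bigr => b _.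
    have tr1 (M : 'M[R]_1) : M 0 0 = M^T 0 0 by rewrite mxE.
    by rewrite [LHS]tr1 !trmx_mul trmxK symD mulmxA.
  transitivity (bil D c c + bil D c c' + (bil D c' c + bil D c' c')).
    rewrite /bil -!big_split/=; apply: eq_bigr => a _.
    rewrite -!big_split/=; apply: eq_bigr => b _.
    by rewrite [(_ + _)^T]linearD/= !mulmxDl !mulmxDr !mxE; ring.
  by rewrite bC; ring.
have hb c c' : bil D1 c c' = bil D2 c c'.
  have := h (fun t => c t + c' t); rewrite !addE// !h => /addrI e; lra.
apply/matrixP => i j.
have E (D : nat -> nat -> 'M[R]_p) :
    bil D (pulse t (delta_mx i 0)) (pulse s (delta_mx j 0)) = D t s i j.
  rewrite /bil (bigD1 (Ordinal tN))//= [X in _ + X]big1 => [|a /eqP at']; last first.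
    rewrite big1// => b _; rewrite /pulse; case: eqP => [ts|_].
      by case: at'; exact: val_inj.
    by rewrite trmx0 !mul0mx mxE.
  rewrite (bigD1 (Ordinal sN))//= [X in _ + X + _]big1 => [|b /eqP bs]; last first.
    rewrite /pulse eqxx; case: eqP => [ts|_].
      by case: bs; exact: val_inj.
    by rewrite mulmx0 mxE.
  by rewrite /pulse !eqxx !addr0 trmx_delta -rowE -colE !mxE.
by rewrite -!E hb.
Qed.

End block_forms.

(** Moving both times one step later adds only the contribution of the earliest noise, so a
    difference of covariances isolates a product of two kernel values. *)
Lemma ma_covS (R : realType) (l p : nat) (Psi : 'M[R]_p) (F : nat -> 'M[R]_(p, l))
  (N t s : nat) :
  ma_cov l p Psi F N.+1 t.+1 s.+1 = F t *m (F s)^T + ma_cov l p Psi F N t s.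
Proof.
rewrite /ma_cov big_ord_recl /= !subn0 eqSS addrA; congr (_ + _ + _).
apply: eq_bigr => tau _; rewrite /bump/= !add1n !ltnS.
by case: ifP => // _; rewrite -!subn1 -!subnDA !add1n.
Qed.

Lemma ma_cov_tr (R : realType) (l p : nat) (Psi : 'M[R]_p) (F : nat -> 'M[R]_(p, l))
  (N t s : nat) : Psi^T = Psi ->
  (ma_cov l p Psi F N t s)^T = ma_cov l p Psi F N s t.
Proof.
move=> Psi_sym; rewrite /ma_cov linearD/= linear_sum/=; congr (_ + _).
  apply: eq_bigr => tau _; rewrite andbC.
  by case: ifP => _; rewrite ?trmx0// trmx_mul trmxK.
by rewrite eq_sym; case: ifP => _; rewrite ?trmx0.
Qed.

(** * Equality in law of two moving averages *)

Section ma_equiv.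
Context {R : realType} (p l1 l2 : nat).
Local Notation mR := (measurableTypeR R).
Context (mu1 : 'cV[R]_l1) (mu2 : 'cV[R]_l2) (Psi1 Psi2 : 'M[R]_p).
Hypothesis (Psi1_sym : Psi1^T = Psi1) (Psi2_sym : Psi2^T = Psi2).
Hypothesis Psi1_psd : forall a : 'cV[R]_p, 0 <= (a^T *m Psi1 *m a) 0 0.
Hypothesis Psi2_psd : forall a : 'cV[R]_p, 0 <= (a^T *m Psi2 *m a) 0 0.
Context {d1 : measure_display} {T1 : measurableType d1} (P1 : probability T1 R).
Context {d2 : measure_display} {T2 : measurableType d2} (P2 : probability T2 R).
Context (w1 : nat -> T1 -> 'cV[R]_l1) (nu1 : nat -> T1 -> 'cV[R]_p).
Context (w2 : nat -> T2 -> 'cV[R]_l2) (nu2 : nat -> T2 -> 'cV[R]_p).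
Hypothesis noise1 : noise_model P1 mu1 Psi1 w1 nu1.
Hypothesis noise2 : noise_model P2 mu2 Psi2 w2 nu2.
Context (dd1 dd2 : nat -> 'cV[R]_p).
Context (F1 : nat -> 'M[R]_(p, l1)) (F2 : nat -> 'M[R]_(p, l2)).

Theorem ma_process_equiv :
  stoch_equiv P1 (ma_process l1 p w1 nu1 dd1 F1) P2 (ma_process l2 p w2 nu2 dd2 F2)
  <-> [/\ Psi1 = Psi2,
          (forall t, ma_mean l1 p mu1 dd1 F1 t = ma_mean l2 p mu2 dd2 F2 t) &
          (forall h k, F1 k *m (F1 h)^T = F2 k *m (F2 h)^T)].
Proof.
rewrite stoch_equiv_lin; last 2 first.
- exact: (measurable_ma_process P1 _ _ mu1 Psi1).
- exact: (measurable_ma_process P2 _ _ mu2 Psi2).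
have law1 := ma_process_lin_law P1 _ _ _ _ _ _ Psi1_psd noise1 dd1 F1.
have law2 := ma_process_lin_law P2 _ _ _ _ _ _ Psi2_psd noise2 dd2 F2.
split => [eqY|[eqPsi eqmean eqF] N c B mB]; last first.
  refine (etrans (law1 N c B mB) (etrans _ (esym (law2 N c B mB)))).
  have -> : \sum_(t < N) ((c t)^T *m ma_mean l1 p mu1 dd1 F1 t) 0 0 =
      \sum_(t < N) ((c t)^T *m ma_mean l2 p mu2 dd2 F2 t) 0 0.
    by apply: eq_bigr => t _; rewrite eqmean.
  have -> // : \sum_(t < N) \sum_(s < N) ((c t)^T *m ma_cov l1 p Psi1 F1 N t s *m c s) 0 0 =
      \sum_(t < N) \sum_(s < N) ((c t)^T *m ma_cov l2 p Psi2 F2 N t s *m c s) 0 0.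
  apply: eq_bigr => t _; apply: eq_bigr => s _.
  have -> // : ma_cov l1 p Psi1 F1 N t s = ma_cov l2 p Psi2 F2 N t s.
  rewrite /ma_cov eqPsi; congr (_ + _); apply: eq_bigr => tau _.
  by rewrite eqF.
have params N c := gauss_prob_inj _ _ _ _
  (ma_var_ge0 l1 p Psi1 Psi1_psd F1 N c) (ma_var_ge0 l2 p Psi2 Psi2_psd F2 N c)
  (fun B mB => etrans (esym (law1 N c B mB))
    (etrans (eqY N c B mB) (law2 N c B mB))).
have eqcov N t s : (t < N)%N -> (s < N)%N ->
    ma_cov l1 p Psi1 F1 N t s = ma_cov l2 p Psi2 F2 N t s.
  apply: block_quadratic_inj => [a b|a b|c].
  - exact: ma_cov_tr.
  - exact: ma_cov_tr.
  - by have [] := params N c.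
split.
(* At time 0 no process noise has acted yet, so the covariance is the measurement noise alone. *)
- have := eqcov 1%N 0%N 0%N isT isT.
  by rewrite /ma_cov !big_ord1/= !add0r.
- move=> t; apply: (block_linear_inj p t.+1) => // c.
  by have [] := params t.+1 c.
(* [N] exceeds [k] and [h], so the blocks at [(k, h)] with horizon [N] and at [(k + 1, h + 1)] with
   horizon [N + 1] are both known to agree. *)
- move=> h k; pose N := (maxn k h).+1.
  have kN : (k < N)%N by rewrite ltnS leq_maxl.
  have hN : (h < N)%N by rewrite ltnS leq_maxr.
  have := eqcov N.+1 k.+1 h.+1 kN hN.
  by rewrite !ma_covS (eqcov N k h)// => /addIr.
Qed.

End ma_equiv.

(** * Linear systems *)

Section linear_systems.
Context {R : realType}.

(** Indexing by lag instead of time turns the sums for successive horizons into partial sums of one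
    sequence, whose terms [sum_inj] then recovers. *)
Lemma sum_subS_rev (V : nmodType) (f : nat -> V) t :
  \sum_(tau < t) f (t.-1 - tau)%N = \sum_(k < t) f k.
Proof.
rewrite (reindex_inj rev_ord_inj)/=; apply: eq_bigr => k _; congr f.
by rewrite -subn1; have := ltn_ord k; lia.
Qed.

Lemma sum_inj (V : zmodType) (f g : nat -> V) :
  (forall t, \sum_(k < t) f k = \sum_(k < t) g k) -> forall t, f t = g t.
Proof.
by move=> h t; have := h t.+1; rewrite !big_ord_recr/= h => /addrI.
Qed.

(** By Cayley-Hamilton, [A ^+ t] is the value at [A] of the remainder of ['X^t] modulo the
    characteristic polynomial, a combination of the first [n] powers. *)
Lemma mulmx_expr_eq0 (n q : nat) (A : 'M[R]_n) (C : 'M[R]_(q, n)) (z : 'cV[R]_n) :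
  (forall t, (t < n)%N -> C *m A ^+ t *m z = 0) ->
  forall t, C *m A ^+ t *m z = 0.
Proof.
case: n A C z => [|n] A C z h t; first by rewrite (flatmx0 z) mulmx0.
set r := 'X^t %% char_poly A.
have rE : A ^+ t = horner_mx A r.
  rewrite -[in LHS](horner_mx_X A) -rmorphXn/= (divp_eq 'X^t (char_poly A)).
  by rewrite rmorphD rmorphM/= Cayley_Hamilton mulr0 add0r.
have sr : (size r <= n.+1)%N.
  rewrite -ltnS -(size_char_poly A) ltn_modp -size_poly_gt0 size_char_poly//.
rewrite rE -(coefK r) poly_def rmorph_sum/= mulmx_sumr mulmx_suml big1// => i _.
rewrite linearZ/= rmorphXn/= horner_mx_X -scalemxAr -scalemxAl h ?scaler0//.
exact: leq_trans (ltn_ord i) sr.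
Qed.

Lemma Obs_eqP (n1 n2 p : nat) (A1 : 'M[R]_n1) (C1 : 'M[R]_(p, n1))
  (A2 : 'M[R]_n2) (C2 : 'M[R]_(p, n2)) k (x1 : 'cV[R]_n1) (x2 : 'cV[R]_n2) :
  Obs A1 C1 k *m x1 = Obs A2 C2 k *m x2 <->
  forall t, (t < k)%N -> C1 *m A1 ^+ t *m x1 = C2 *m A2 ^+ t *m x2.
Proof.
elim: k x1 x2 => [|k IHk] x1 x2.
  by split => // _; rewrite [LHS]flatmx0 [RHS]flatmx0.
have ObsS n (A : 'M[R]_n) (C : 'M[R]_(p, n)) (x : 'cV[R]_n) :
    Obs A C k.+1 *m x = col_mx (C *m x) (Obs A C k *m (A *m x)).
  by rewrite mulmxA; exact: mul_col_mx.
rewrite !ObsS; split => [/eq_col_mx[h0 hk] [|t] tk|h].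
- by rewrite !expr0 !mulmx1.
- have := (IHk _ _).1 hk t tk.
  by rewrite !exprSr -!mulmxE !mulmxA.
- congr col_mx; first by have := h 0%N isT; rewrite !expr0 !mulmx1.
  apply/IHk => t tk; have := h t.+1 tk.
  by rewrite !exprSr -!mulmxE !mulmxA.
Qed.

Lemma block_diag_expr (n1 n2 : nat) (A1 : 'M[R]_n1) (A2 : 'M[R]_n2) t :
  (block_mx A1 0 0 A2) ^+ t = block_mx (A1 ^+ t) 0 0 (A2 ^+ t).
Proof.
elim: t => [|t IHt]; first by rewrite !expr0 -scalar_mx_block.
rewrite !exprS IHt -!mulmxE mulmx_block.
by rewrite !mulmx0 !mul0mx !addr0 !add0r.
Qed.

(** The difference of the two free responses is the free response of one composite system, which
    brings the comparison of states under [mulmx_expr_eq0]. *)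
Lemma block_diag_obs (n1 n2 p : nat) (A1 : 'M[R]_n1) (C1 : 'M[R]_(p, n1))
  (A2 : 'M[R]_n2) (C2 : 'M[R]_(p, n2)) t (x1 : 'cV[R]_n1) (x2 : 'cV[R]_n2) :
  row_mx C1 (- C2) *m (block_mx A1 0 0 A2) ^+ t *m col_mx x1 x2 =
  C1 *m A1 ^+ t *m x1 - C2 *m A2 ^+ t *m x2.
Proof.
rewrite block_diag_expr mul_row_block mul_row_col !mulmx0 addr0 add0r.
by rewrite !mulNmx.
Qed.

(** The output with both noises set to zero: the deterministic part of the moving average. *)
Definition forced_mean (n m p : nat) (A : 'M[R]_n) (B : 'M[R]_(n, m))
    (C : 'M[R]_(p, n)) (x0 : 'cV[R]_n) (u : nat -> 'cV[R]_m) (t : nat) : 'cV[R]_p :=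
  C *m A ^+ t *m x0 + \sum_(tau < t) C *m A ^+ (t.-1 - tau) *m B *m u tau.

Lemma output_trajE {d : measure_display} {T : measurableType d}
  (n m l p : nat) (A : 'M[R]_n) (B : 'M[R]_(n, m))
  (G : 'M[R]_(n, l)) (C : 'M[R]_(p, n)) (w : nat -> T -> 'cV[R]_l)
  (nu : nat -> T -> 'cV[R]_p) (x0 : 'cV[R]_n) (u : nat -> 'cV[R]_m) :
  output_traj A B G C w nu x0 u =
  ma_process l p w nu (forced_mean n m p A B C x0 u) (fun k => C *m A ^+ k *m G).
Proof.
apply/funext => t; apply/funext => om.
rewrite /output_traj /state_traj /ma_process /forced_mean; congr (_ + _).
rewrite mulmxDr mulmxA -addrA; congr (_ + _).
rewrite mulmx_sumr -big_split/=; apply: eq_bigr => tau _.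
by rewrite !mulmxDr !mulmxA.
Qed.

End linear_systems.

(** Symmetry and positive semidefiniteness say that [Psi1] and [Psi2] are covariance matrices,
    possibly singular. A pair of initial states is encoded as a stacked column. *)
Theorem theorem1 (R : realType) (n1 n2 m l1 l2 p : nat)
  (A1 : 'M[R]_n1) (B1 : 'M[R]_(n1, m)) (G1 : 'M[R]_(n1, l1)) (C1 : 'M[R]_(p, n1))
  (A2 : 'M[R]_n2) (B2 : 'M[R]_(n2, m)) (G2 : 'M[R]_(n2, l2)) (C2 : 'M[R]_(p, n2))
  (mu1 : 'cV[R]_l1) (mu2 : 'cV[R]_l2) (Psi1 Psi2 : 'M[R]_p)
  (Psi1_sym : Psi1^T = Psi1) (Psi2_sym : Psi2^T = Psi2)
  (Psi1_psd : forall a : 'cV[R]_p, 0 <= (a^T *m Psi1 *m a) 0 0)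
  (Psi2_psd : forall a : 'cV[R]_p, 0 <= (a^T *m Psi2 *m a) 0 0)
  (d1 : measure_display) (T1 : measurableType d1) (P1 : probability T1 R)
  (w1 : nat -> T1 -> 'cV[R]_l1) (nu1 : nat -> T1 -> 'cV[R]_p)
  (d2 : measure_display) (T2 : measurableType d2) (P2 : probability T2 R)
  (w2 : nat -> T2 -> 'cV[R]_l2) (nu2 : nat -> T2 -> 'cV[R]_p)
  (noise1 : noise_model P1 mu1 Psi1 w1 nu1)
  (noise2 : noise_model P2 mu2 Psi2 w2 nu2)
  (Rs : set 'cV[R]_(n1 + n2)) (Rs_sub : is_subspace Rs) :
  let equiv_wrt (S : set 'cV[R]_(n1 + n2)) : Prop :=
    forall (x1 : 'cV[R]_n1) (x2 : 'cV[R]_n2) (u : nat -> 'cV[R]_m),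
      S (col_mx x1 x2) ->
      stoch_equiv P1 (output_traj A1 B1 G1 C1 w1 nu1 x1 u)
                  P2 (output_traj A2 B2 G2 C2 w2 nu2 x2 u) in
  (equiv_wrt Rs <->
     [/\ Psi1 = Psi2,
         (forall t : nat, C1 *m A1 ^+ t *m B1 = C2 *m A2 ^+ t *m B2),
         (forall t : nat, C1 *m A1 ^+ t *m G1 *m mu1 = C2 *m A2 ^+ t *m G2 *m mu2),
         (forall h k : nat,
            C1 *m A1 ^+ k *m G1 *m G1^T *m (A1 ^+ h)^T *m C1^T =
            C2 *m A2 ^+ k *m G2 *m G2^T *m (A2 ^+ h)^T *m C2^T) &
         (forall z, Rs z ->
            row_mx (Obs A1 C1 (n1 + n2)) (- Obs A2 C2 (n1 + n2)) *m z = 0)])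
  /\
  (equiv_wrt Rs ->
     exists Rs' : set 'cV[R]_(n1 + n2),
       [/\ is_subspace Rs',
           (forall z, Rs' z -> Rs' (block_mx A1 0 0 A2 *m z)),
           Rs `<=` Rs' &
           equiv_wrt Rs']).
Proof.
move=> equiv_wrt.
have equivP x1 x2 u :
    stoch_equiv P1 (output_traj A1 B1 G1 C1 w1 nu1 x1 u)
                P2 (output_traj A2 B2 G2 C2 w2 nu2 x2 u) <->
    [/\ Psi1 = Psi2,
        (forall t, forced_mean n1 m p A1 B1 C1 x1 u t +
             \sum_(k < t) C1 *m A1 ^+ k *m G1 *m mu1 =
           forced_mean n2 m p A2 B2 C2 x2 u t +
             \sum_(k < t) C2 *m A2 ^+ k *m G2 *m mu2) &
        (forall h k : nat,
            C1 *m A1 ^+ k *m G1 *m G1^T *m (A1 ^+ h)^T *m C1^T =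
            C2 *m A2 ^+ k *m G2 *m G2^T *m (A2 ^+ h)^T *m C2^T)].
  rewrite !output_trajE.
  rewrite (ma_process_equiv _ _ _ mu1 mu2 _ _ Psi1_sym Psi2_sym)//.
  rewrite /ma_mean.
  split => -[hPsi hm hF]; split => //.
  - move=> t; have := hm t.
    by rewrite !(sum_subS_rev _ (fun k => C1 *m A1 ^+ k *m G1 *m mu1))
               !(sum_subS_rev _ (fun k => C2 *m A2 ^+ k *m G2 *m mu2)).
  - by move=> h k; have := hF h k; rewrite !trmx_mul !mulmxA.
  - move=> t; rewrite (sum_subS_rev _ (fun k => C1 *m A1 ^+ k *m G1 *m mu1)).
    by rewrite (sum_subS_rev _ (fun k => C2 *m A2 ^+ k *m G2 *m mu2)).
  - by move=> h k; rewrite !trmx_mul !mulmxA.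
(* The composite system has dimension [n1 + n2], so agreement of the free responses up to that
   horizon forces agreement at all times. *)
have obsP (x1 : 'cV[R]_n1) (x2 : 'cV[R]_n2) :
    row_mx (Obs A1 C1 (n1 + n2)) (- Obs A2 C2 (n1 + n2)) *m col_mx x1 x2 = 0 <->
    forall t, C1 *m A1 ^+ t *m x1 = C2 *m A2 ^+ t *m x2.
  rewrite mul_row_col mulNmx; split.
    move=> /subr0_eq /Obs_eqP h t; apply/eqP.
    rewrite -subr_eq0 -block_diag_obs; apply/eqP; apply: mulmx_expr_eq0 => s sn.
    by rewrite block_diag_obs h// subrr.
  move=> h; apply/eqP; rewrite subr_eq0; apply/eqP.
  by apply/Obs_eqP => t _; exact: h.
(* Stated for an arbitrary set of states, so as to serve both the given subspace and its invariant
   extension. *)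
have sufficient (S : set 'cV[R]_(n1 + n2)) :
    Psi1 = Psi2 ->
    (forall t, C1 *m A1 ^+ t *m B1 = C2 *m A2 ^+ t *m B2) ->
    (forall t, C1 *m A1 ^+ t *m G1 *m mu1 = C2 *m A2 ^+ t *m G2 *m mu2) ->
    (forall h k, C1 *m A1 ^+ k *m G1 *m G1^T *m (A1 ^+ h)^T *m C1^T =
                 C2 *m A2 ^+ k *m G2 *m G2^T *m (A2 ^+ h)^T *m C2^T) ->
    (forall (x1 : 'cV[R]_n1) (x2 : 'cV[R]_n2), S (col_mx x1 x2) ->
       forall t, C1 *m A1 ^+ t *m x1 = C2 *m A2 ^+ t *m x2) -> equiv_wrt S.
  move=> p0 p1 p2 p3 p4 x1 x2 u Sx; apply/equivP; split => // t.
  rewrite /forced_mean (p4 _ _ Sx); congr (_ + _ + _).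
    by apply: eq_bigr => tau _; rewrite p1.
  by apply: eq_bigr => k _; rewrite p2.
have necessary : equiv_wrt Rs ->
    [/\ Psi1 = Psi2,
        (forall t, C1 *m A1 ^+ t *m B1 = C2 *m A2 ^+ t *m B2),
        (forall t, C1 *m A1 ^+ t *m G1 *m mu1 = C2 *m A2 ^+ t *m G2 *m mu2),
        (forall h k, C1 *m A1 ^+ k *m G1 *m G1^T *m (A1 ^+ h)^T *m C1^T =
                     C2 *m A2 ^+ k *m G2 *m G2^T *m (A2 ^+ h)^T *m C2^T) &
        (forall (x1 : 'cV[R]_n1) (x2 : 'cV[R]_n2), Rs (col_mx x1 x2) ->
           forall t, C1 *m A1 ^+ t *m x1 = C2 *m A2 ^+ t *m x2)].
  move=> eqR; have Rs0 : Rs (col_mx 0 0) by rewrite col_mx0; case: Rs_sub.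
  (* Zero state and zero input leave only the noise contributions. *)
  have [p0 hm0 p3] := (equivP _ _ _).1 (eqR 0 0 (fun=> 0) Rs0).
  have force0 n (A : 'M[R]_n) (B : 'M[R]_(n, m)) (C : 'M[R]_(p, n)) (x : 'cV[R]_n) t :
      forced_mean n m p A B C x (fun=> 0) t = C *m A ^+ t *m x.
    by rewrite /forced_mean big1 ?addr0// => tau _; rewrite mulmx0.
  have hG t : \sum_(k < t) C1 *m A1 ^+ k *m G1 *m mu1 =
              \sum_(k < t) C2 *m A2 ^+ k *m G2 *m mu2.
    by have := hm0 t; rewrite !force0 !mulmx0 !add0r.
  split => //.
  - move=> t; apply/matrixP => i j.
    (* An impulse at time 0 on input channel [j]: the response at time [t + 1] is column [j] of
       [C A^t B]. *)
    pose u (tau : nat) : 'cV[R]_m := if tau == 0%N then delta_mx j 0 else 0.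
    have [_ hm _] := (equivP _ _ _).1 (eqR 0 0 u Rs0).
    have E n (A : 'M[R]_n) (B : 'M[R]_(n, m)) (C : 'M[R]_(p, n)) :
        forced_mean n m p A B C 0 u t.+1 = C *m A ^+ t *m B *m delta_mx j 0.
      rewrite /forced_mean mulmx0 add0r big_ord_recl big1 ?addr0 ?subn0//.
      by move=> tau _; rewrite mulmx0.
    have := hm t.+1; rewrite !E hG => /addIr; rewrite -!colE => /colP/(_ i).
    by rewrite !mxE.
  - exact: sum_inj hG.
  (* With zero input and the noise means already matched, only the free responses remain. *)
  - move=> x1 x2 Sx t.
    have [_ hm _] := (equivP _ _ _).1 (eqR x1 x2 (fun=> 0) Sx).
    by have := hm t; rewrite !force0 hG => /addIr.
split.
  split => [/necessary[p0 p1 p2 p3 p4]|[p0 p1 p2 p3 p4]].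
    split => // z; rewrite -[z]vsubmxK => Rz; apply/obsP => t; exact: p4.
  by apply: sufficient => // x1 x2 Sx; apply/obsP/p4.
move=> /necessary[p0 p1 p2 p3 p4].
pose A := block_mx A1 0 0 A2.
(* Asking for every power [t] makes invariance a mere shift of the index: the condition on the image
   of [z] at [t] is that on [z] at [t + 1]. *)
exists [set z | forall t, row_mx C1 (- C2) *m A ^+ t *m z = 0]; split.
- split => [t|a x y hx hy t]; first by rewrite mulmx0.
  by rewrite mulmxDr -scalemxAr hx hy scaler0 addr0.
- move=> z hz t; have := hz t.+1.
  by rewrite exprSr -mulmxE !mulmxA.
- move=> z; rewrite -[z]vsubmxK => Rz t.
  by rewrite block_diag_obs (p4 _ _ Rz) subrr.
- apply: sufficient => // x1 x2 Sx t; apply/eqP; rewrite -subr_eq0.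
  by rewrite -block_diag_obs Sx.
Qed.
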